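(* Consider the robust Markov decision process (RMDP) problem $\min_{\pi\in\Pi}\max_{p\in\mathcal P}J_\rho(\pi,p)$ with bounded costs, $s$-rectangular ambiguity set and bounded distribution mismatch coefficient, and the Single-loop Robust Policy Gradient method (SRPG), with the parameters $r_1,r_2,\tau,\sigma,\mu$ fixed and satisfying the parameter conditions listed in the context. Suppose that, when SRPG is run for $K$ iterations, $\beta=\beta_K$ satisfies the parameter conditions and is of order $K^{-1/2}$, i.e. $c_1K^{-1/2}\le \beta_K\le c_2K^{-1/2}$ for constants $0<c_1\le c_2$ independent of $K$. Then there is a constant $C>0$, independent of $K$, of the initial point and of $D_\Pi,D_{\mathcal P}$ (it may depend on $S,A,\gamma,\rho$, the mismatch coefficient $D$, $L,\lambda,r_1,r_2,\tau,\sigma,\mu,c_1,c_2$), such that for every integer $K\ge 2$: 1. there exists a positive integer $k_1<K$ such that $(\pi_{k_1+1},p_{k_1+1})$ is an $\varepsilon_K$-game stationary point; 2. there exists a positive integer $k_2<K$ such that $\bar\pi_{k_2+1}$ is an $\varepsilon_K$-optimization stationary point; where $\varepsilon_K:=C\,(D_\Pi^{1/2}+D_{\mathcal P}^{1/2})/K^{1/4}$, $D_\Pi:=\max_{\pi_1,\pi_2\in\Pi}\|\pi_1-\pi_2\|$ and $D_{\mathcal P}:=\max_{p_1,p_2\in\mathcal P}\|p_1-p_2\|$.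
   Context: **RMDP.** States $\mathcal S=\{1,\dots,S\}$, actions $\mathcal A=\{1,\dots,A\}$, discount factor $\gamma\in(0,1)$, initial distribution $\rho\in\Delta^S$ ($\Delta^d$ is the probability simplex in $\mathbb R^d$), costs $c_{sas'}\in[0,1]$ (bounded cost assumption). A transition kernel is $p=(p_{sa})_{s,a}\in(\Delta^S)^{S\times A}$; policies form $\Pi=(\Delta^A)^S$. The value function is $v_s^{\pi,p}=\mathbb E_{\pi,p}[\sum_{t\ge0}\gamma^t c_{s_ta_ts_{t+1}}\mid s_0=s]$, and $J_\rho(\pi,p)=\sum_s\rho_s v_s^{\pi,p}$. The ambiguity set $\mathcal P\subseteq(\Delta^S)^{S\times A}$ is nonempty, compact, convex and $s$-rectangular: $\mathcal P=\mathcal P_1\times\cdots\times\mathcal P_S$, where $\mathcal P_s$ constrains $(p_{sa})_{a\in\mathcal A}$. Put $\phi(\pi):=\max_{p\in\mathcal P}J_\rho(\pi,p)$. $\|\cdot\|$ is the Euclidean/Frobenius norm. **Bounded mismatch.** $d_\rho^{\pi,p}(s')=(1-\gamma)\sum_{s}\sum_{t\ge0}\gamma^t\rho(s)p^\pi_{ss'}(t)$, where $p^\pi_{ss'}(t)$ is the probability of being in $s'$ after $t$ steps from $s$ under $(\pi,p)$. The distribution mismatch coefficient $D=\|d_\rho^{\pi,p}/\rho\|_\infty$ (componentwise ratio) is assumed finite for $p=p^*(\pi)\in\arg\max_{p\in\mathcal P}J_\rho(\pi,p)$ for all $\pi\in\Pi$, and for $\pi=\pi^*(p)\in\arg\min_{\pi\in\Pi}J_\rho(\pi,p)$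 for all $p\in\mathcal P$. **Constants.** $\ell_\pi:=2\gamma A/(1-\gamma)^3$. $\ell_{\pi p},\ell_{p\pi}>0$ are constants with $\|\nabla_\pi J_\rho(\pi,p)-\nabla_\pi J_\rho(\pi',p')\|\le\ell_{\pi p}(\|\pi-\pi'\|+\|p-p'\|)$ and $\|\nabla_p J_\rho(\pi,p)-\nabla_p J_\rho(\pi',p')\|\le\ell_{p\pi}(\|\pi-\pi'\|+\|p-p'\|)$ for all $\pi,\pi'\in\Pi$, $p,p'\in\mathcal P$. Write $L:=\ell_{\pi p}$ and $\ell_{p\pi}=\lambda L$. **SRPG.** Let $\chi(\pi,p,\bar\pi,\bar p):=J_\rho(\pi,p)+\frac{r_1}{2}\|\pi-\bar\pi\|^2-\frac{r_2}{2}\|p-\bar p\|^2$. Start from $\pi_0=\bar\pi_0\in\Pi$, $p_0=\bar p_0\in\mathcal P$; for $k=0,\dots,K-1$: $\pi_{k+1}=\mathrm{Proj}_\Pi(\pi_k-\tau\nabla_\pi\chi(\pi_k,p_k,\bar\pi_k,\bar p_k))$, $p_{k+1}=\mathrm{Proj}_{\mathcal P}(p_k+\sigma\nabla_p\chi(\pi_{k+1},p_k,\bar\pi_k,\bar p_k))$, $\bar\pi_{k+1}=\bar\pi_k+\beta(\pi_{k+1}-\bar\pi_k)$, $\bar p_{k+1}=\bar p_k+\mu(p_{k+1}-\bar p_k)$, with $\tau,\sigma>0$, $0<\beta,\mu<1$. **Parameter conditions.** $r_1\ge2L$, $r_1>\ell_\pi$, $r_2\ge2\lambda L$, and $0<\tau\le\min\{\frac{4}{3(L+r_1)},\frac1{6\lambda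 L}\}$, $0<\sigma\le\min\{\frac{2}{3\lambda L\kappa_6^2},\frac{1}{6L_{\phi\pi}},\frac{1}{5\lambda\sqrt{\lambda+5}\,L}\}$, $0<\beta\le\min\{\frac{24r_1}{360r_1+5r_1^2\lambda+(2\lambda L+5r_1)^2},\frac{\sigma\lambda^2L^2}{384r_1(\lambda+5)(\lambda+1)^2}\}$, $0<\mu\le\min\{\frac{\lambda+5}{2(\lambda+5)+\lambda^2L^2},\frac{\lambda+5}{\sigma\lambda^2L^2},\frac{\sigma\lambda^2L^2}{64r_2(\lambda+5)}\}$, where $\kappa_6=\frac{2\tau r_1+1}{\tau(r_1-L)}$, $\kappa_1=\frac{\ell_{p\pi}+r_1-\ell_{\pi p}}{r_1-\ell_{\pi p}}$, $L_{\phi\pi}=\ell_{p\pi}\kappa_1+\ell_{p\pi}+r_2$. **Stationarity.** With $\mathcal N_\Pi,\mathcal N_{\mathcal P}$ the normal cones, $(\pi,p)\in\Pi\times\mathcal P$ is an $\varepsilon$-game stationary point if $\mathrm{dist}(0,\nabla_\pi J_\rho(\pi,p)+\mathcal N_\Pi(\pi))\le\varepsilon$ and $\mathrm{dist}(0,-\nabla_pJ_\rho(\pi,p)+\mathcal N_{\mathcal P}(p))\le\varepsilon$. $\pi$ is an $\varepsilon$-optimization stationary point if $\|\mathrm{prox}_{\phi,r_1}(\pi)-\pi\|\le\varepsilon$, where $\mathrm{prox}_{\phi,r_1}(\pi)=\arg\min_{\tilde\pi\in\Pi}\{\phi(\tilde\pi)+\frac{r_1}{2}\|\tilde\pi-\pi\|^2\}$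 and $r_1>\ell_\pi$. *)

(* Defs.v *)
From HB Require Import structures.
From mathcomp Require Import all_boot all_order all_algebra.
From mathcomp Require Import all_classical all_reals all_analysis.

Set Implicit Arguments.
Unset Strict Implicit.
Unset Printing Implicit Defensive.

Import Order.TTheory GRing.Theory Num.Theory.
Import numFieldNormedType.Exports.
Local Open Scope classical_set_scope.
Local Open Scope ring_scope.

(* The library norm `|x| on matrices is the sup norm, whereas all norms of the
   statement are Euclidean/Frobenius norms.  Both induce the same topology, so
   that [compact] and ['D_v f] are used as they are. *)
Definition frob {R : realType} {m n : nat} (x : 'M[R]_(m, n)) : R :=
  Num.sqrt (\sum_i \sum_j x i j ^+ 2).

Definition inner {R : realType} {m n : nat} (x y : 'M[R]_(m, n)) : R :=
  \sum_i \sum_j x i j * y i j.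

Definition grad {R : realType} {m n : nat} (f : 'M[R]_(m, n) -> R)
    (x : 'M[R]_(m, n)) : 'M[R]_(m, n) :=
  \matrix_(i, j) 'D_(delta_mx i j) f x.

Definition argmin {R : realType} {T : Type} (C : set T) (f : T -> R) : set T :=
  [set x | C x /\ forall y, C y -> f x <= f y].

Definition argmax {R : realType} {T : Type} (C : set T) (f : T -> R) : set T :=
  [set x | C x /\ forall y, C y -> f y <= f x].

(* The Euclidean projections of x on C, as a set (a singleton when C is
   nonempty, closed and convex). *)
Definition Proj {R : realType} {m n : nat} (C : set 'M[R]_(m, n))
    (x : 'M[R]_(m, n)) : set 'M[R]_(m, n) :=
  argmin C (fun y => frob (y - x)).

Definition normal_cone {R : realType} {m n : nat} (C : set 'M[R]_(m, n))
    (x : 'M[R]_(m, n)) : set 'M[R]_(m, n) :=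
  [set g | forall y, C y -> inner g (y - x) <= 0].

Definition dist {R : realType} {m n : nat} (x : 'M[R]_(m, n))
    (C : set 'M[R]_(m, n)) : R :=
  inf [set frob (x - y) | y in C].

Definition diameter {R : realType} {m n : nat} (C : set 'M[R]_(m, n)) : R :=
  sup [set d | exists x y, [/\ C x, C y & d = frob (x - y)]].

Definition simplex {R : realType} (d : nat) : set 'rV[R]_d :=
  [set x | (forall i, 0 <= x 0 i) /\ \sum_i x 0 i = 1].

Definition policies (R : realType) (nS nA : nat) : set 'M[R]_(nS, nA) :=
  [set pi | forall s, simplex (row s pi)].
Arguments policies R nS nA : clear implicits.

(* A family (p_{sas'}) is stored as a matrix whose row s is the flattening of
   the nA x nS matrix p_s = (p_{sas'})_{a,s'}. *)
Definition slice {R : realType} {nS nA : nat} (p : 'M[R]_(nS, nA * nS))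
    (s : 'I_nS) : 'M[R]_(nA, nS) := vec_mx (row s p).

Definition kernels (R : realType) (nS nA : nat) : set 'M[R]_(nS, nA * nS) :=
  [set p | forall s a, simplex (row a (slice p s))].
Arguments kernels R nS nA : clear implicits.

Definition s_rectangular {R : realType} {nS nA : nat}
    (P : set 'M[R]_(nS, nA * nS)) : Prop :=
  exists P_ : 'I_nS -> set 'M[R]_(nA, nS),
    P = [set p | forall s, P_ s (slice p s)].

(* Probability that the process started at s takes the actions and visits the
   states listed by w = [:: (a_0, s_1); (a_1, s_2); ...]. *)
Fixpoint traj_prob {R : realType} {nS nA : nat} (pi : 'M[R]_(nS, nA))
    (p : 'M[R]_(nS, nA * nS)) (s : 'I_nS) (w : seq ('I_nA * 'I_nS)) : R :=
  if w is (a, s') :: w' then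
    pi s a * slice p s a s' * traj_prob pi p s' w'
  else 1.

Definition end_state {nS nA : nat} (s : 'I_nS) (w : seq ('I_nA * 'I_nS)) :
  'I_nS := last s (unzip2 w).

(* p^pi_{ss'}(t) *)
Definition visit_prob {R : realType} {nS nA : nat} (pi : 'M[R]_(nS, nA))
    (p : 'M[R]_(nS, nA * nS)) (t : nat) (s s' : 'I_nS) : R :=
  \sum_(w : t.-tuple ('I_nA * 'I_nS) | end_state s w == s') traj_prob pi p s w.

(* E[c_{s_t a_t s_{t+1}} | s_0 = s]; only the first t + 1 transitions are
   involved. *)
Definition expected_cost {R : realType} {nS nA : nat}
    (c : 'I_nS -> 'I_nA -> 'I_nS -> R) (pi : 'M[R]_(nS, nA))
    (p : 'M[R]_(nS, nA * nS)) (s : 'I_nS) (t : nat) : R :=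
  \sum_(w : t.-tuple ('I_nA * 'I_nS)) \sum_a \sum_s'
    traj_prob pi p s (rcons w (a, s')) * c (end_state s w) a s'.

(* The expectation is taken termwise (bounded costs, 0 < gamma < 1).  The
   formula also makes sense for (pi, p) near policies x kernels, and grad below
   differentiates it with all entries of pi or of p as free variables; this is
   the direct parameterization of the policy gradient theorem. *)
Definition value {R : realType} {nS nA : nat} (gamma : R)
    (c : 'I_nS -> 'I_nA -> 'I_nS -> R) (pi : 'M[R]_(nS, nA))
    (p : 'M[R]_(nS, nA * nS)) (s : 'I_nS) : R :=
  limn (series (fun t => gamma ^+ t * expected_cost c pi p s t)).

Definition J {R : realType} {nS nA : nat} (gamma : R) (rho : 'rV[R]_nS)
    (c : 'I_nS -> 'I_nA -> 'I_nS -> R) (pi : 'M[R]_(nS, nA))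
    (p : 'M[R]_(nS, nA * nS)) : R :=
  \sum_s rho 0 s * value gamma c pi p s.

(* max_{p in P} J(pi, p); the maximum is attained as P is compact *)
Definition phi {R : realType} {nS nA : nat} (gamma : R) (rho : 'rV[R]_nS)
    (c : 'I_nS -> 'I_nA -> 'I_nS -> R) (P : set 'M[R]_(nS, nA * nS))
    (pi : 'M[R]_(nS, nA)) : R :=
  sup [set J gamma rho c pi p | p in P].

Definition occupancy {R : realType} {nS nA : nat} (gamma : R) (rho : 'rV[R]_nS)
    (pi : 'M[R]_(nS, nA)) (p : 'M[R]_(nS, nA * nS)) (s' : 'I_nS) : R :=
  (1 - gamma) * \sum_s
    limn (series (fun t => gamma ^+ t * rho 0 s * visit_prob pi p t s s')).

(* ||d / rho||_oo in the extended reals: x / 0 = +oo for x > 0, 0 / 0 = 0 *)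
Definition mismatch {R : realType} {nS nA : nat} (gamma : R) (rho : 'rV[R]_nS)
    (pi : 'M[R]_(nS, nA)) (p : 'M[R]_(nS, nA * nS)) : \bar R :=
  (\big[maxe/0]_(s' < nS)
     `|(occupancy gamma rho pi p s')%:E / (rho 0 s')%:E|)%E.

Definition bounded_mismatch {R : realType} {nS nA : nat} (gamma : R)
    (rho : 'rV[R]_nS) (c : 'I_nS -> 'I_nA -> 'I_nS -> R)
    (P : set 'M[R]_(nS, nA * nS)) (D : R) : Prop :=
  (forall pi, policies R nS nA pi ->
     exists2 p, argmax P (J gamma rho c pi) p &
       (mismatch gamma rho pi p <= D%:E)%E) /\
  (forall p, P p ->
     exists2 pi, argmin (policies R nS nA) (fun q => J gamma rho c q p) pi &
       (mismatch gamma rho pi p <= D%:E)%E).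

Definition grad_pi_lipschitz {R : realType} {nS nA : nat} (gamma : R)
    (rho : 'rV[R]_nS) (c : 'I_nS -> 'I_nA -> 'I_nS -> R)
    (P : set 'M[R]_(nS, nA * nS)) (l : R) : Prop :=
  forall pi pi' p p', policies R nS nA pi -> policies R nS nA pi' ->
    P p -> P p' ->
    frob (grad (fun q => J gamma rho c q p) pi -
          grad (fun q => J gamma rho c q p') pi')
      <= l * (frob (pi - pi') + frob (p - p')).

Definition grad_p_lipschitz {R : realType} {nS nA : nat} (gamma : R)
    (rho : 'rV[R]_nS) (c : 'I_nS -> 'I_nA -> 'I_nS -> R)
    (P : set 'M[R]_(nS, nA * nS)) (l : R) : Prop :=
  forall pi pi' p p', policies R nS nA pi -> policies R nS nA pi' ->
    P p -> P p' ->
    frob (grad (J gamma rho c pi) p - grad (J gamma rho c pi') p')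
      <= l * (frob (pi - pi') + frob (p - p')).

Definition chi {R : realType} {nS nA : nat} (gamma : R) (rho : 'rV[R]_nS)
    (c : 'I_nS -> 'I_nA -> 'I_nS -> R) (r1 r2 : R)
    (pi : 'M[R]_(nS, nA)) (p : 'M[R]_(nS, nA * nS))
    (bpi : 'M[R]_(nS, nA)) (bp : 'M[R]_(nS, nA * nS)) : R :=
  J gamma rho c pi p + r1 / 2 * frob (pi - bpi) ^+ 2
                     - r2 / 2 * frob (p - bp) ^+ 2.

(* (pi, p, bpi, bp) are the iterates of K iterations of SRPG; their values at
   indices > K are irrelevant. *)
Definition srpg_run {R : realType} {nS nA : nat} (gamma : R) (rho : 'rV[R]_nS)
    (c : 'I_nS -> 'I_nA -> 'I_nS -> R) (P : set 'M[R]_(nS, nA * nS))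
    (r1 r2 tau sigma beta mu : R) (K : nat)
    (pi : nat -> 'M[R]_(nS, nA)) (p : nat -> 'M[R]_(nS, nA * nS))
    (bpi : nat -> 'M[R]_(nS, nA)) (bp : nat -> 'M[R]_(nS, nA * nS)) : Prop :=
  [/\ policies R nS nA (pi 0%N), bpi 0%N = pi 0%N, P (p 0%N), bp 0%N = p 0%N &
    forall k, (k < K)%N ->
    [/\ Proj (policies R nS nA)
          (pi k - tau *: grad (fun q =>
             chi gamma rho c r1 r2 q (p k) (bpi k) (bp k)) (pi k)) (pi k.+1),
        Proj P
          (p k + sigma *: grad (fun q =>
             chi gamma rho c r1 r2 (pi k.+1) q (bpi k) (bp k)) (p k)) (p k.+1),
        bpi k.+1 = bpi k + beta *: (pi k.+1 - bpi k) &
        bp k.+1 = bp k + mu *: (p k.+1 - bp k)]].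

Definition game_stationary {R : realType} {nS nA : nat} (gamma : R)
    (rho : 'rV[R]_nS) (c : 'I_nS -> 'I_nA -> 'I_nS -> R)
    (P : set 'M[R]_(nS, nA * nS)) (eps : R)
    (pi : 'M[R]_(nS, nA)) (p : 'M[R]_(nS, nA * nS)) : Prop :=
  [/\ policies R nS nA pi, P p,
      dist 0 [set grad (fun q => J gamma rho c q p) pi + g
               | g in normal_cone (policies R nS nA) pi] <= eps &
      dist 0 [set - grad (J gamma rho c pi) p + g
               | g in normal_cone P p] <= eps].

(* prox_{phi, r}(pi), as a set (a singleton when r > ell_pi) *)
Definition prox_phi {R : realType} {nS nA : nat} (gamma : R) (rho : 'rV[R]_nS)
    (c : 'I_nS -> 'I_nA -> 'I_nS -> R) (P : set 'M[R]_(nS, nA * nS)) (r : R)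
    (pi : 'M[R]_(nS, nA)) : set 'M[R]_(nS, nA) :=
  argmin (policies R nS nA)
    (fun q => phi gamma rho c P q + r / 2 * frob (q - pi) ^+ 2).

Definition opt_stationary {R : realType} {nS nA : nat} (gamma : R)
    (rho : 'rV[R]_nS) (c : 'I_nS -> 'I_nA -> 'I_nS -> R)
    (P : set 'M[R]_(nS, nA * nS)) (r1 eps : R) (pi : 'M[R]_(nS, nA)) : Prop :=
  policies R nS nA pi /\
  exists2 q, prox_phi gamma rho c P r1 pi q & frob (q - pi) <= eps.

Definition ell_pi {R : realType} (nA : nat) (gamma : R) : R :=
  2 * gamma * nA%:R / (1 - gamma) ^+ 3.

(* In the constants below ell_{pi p} = L and ell_{p pi} = lambda * L. *)
Definition kappa1 {R : realType} (L lambda r1 : R) : R :=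
  (lambda * L + r1 - L) / (r1 - L).

Definition kappa6 {R : realType} (L r1 tau : R) : R :=
  (2 * tau * r1 + 1) / (tau * (r1 - L)).

Definition L_phi_pi {R : realType} (L lambda r1 r2 : R) : R :=
  lambda * L * kappa1 L lambda r1 + lambda * L + r2.

Definition tau_max {R : realType} (L lambda r1 : R) : R :=
  Num.min (4 / (3 * (L + r1))) (1 / (6 * lambda * L)).

Definition sigma_max {R : realType} (L lambda r1 r2 tau : R) : R :=
  Num.min (2 / (3 * lambda * L * kappa6 L r1 tau ^+ 2))
  (Num.min (1 / (6 * L_phi_pi L lambda r1 r2))
           (1 / (5 * lambda * Num.sqrt (lambda + 5) * L))).

Definition beta_max {R : realType} (L lambda r1 sigma : R) : R :=
  Num.min
    (24 * r1 / (360 * r1 + 5 * r1 ^+ 2 * lambda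
                + (2 * lambda * L + 5 * r1) ^+ 2))
    (sigma * lambda ^+ 2 * L ^+ 2
       / (384 * r1 * (lambda + 5) * (lambda + 1) ^+ 2)).

Definition mu_max {R : realType} (L lambda r2 sigma : R) : R :=
  Num.min ((lambda + 5) / (2 * (lambda + 5) + lambda ^+ 2 * L ^+ 2))
  (Num.min ((lambda + 5) / (sigma * lambda ^+ 2 * L ^+ 2))
           (sigma * lambda ^+ 2 * L ^+ 2 / (64 * r2 * (lambda + 5)))).

(* Main.v *)
(* Write x = pi, y = p, z = bar pi, v = bar p, f = J, and put
     D(y, z) = min_x f(x, y) + r1/2 |x - z|^2,   q(z) = max_y D(y, z).
   With F(x, y, z, v) = f(x, y) + r1/2 |x - z|^2 - r2/2 |y - v|^2, the Lyapunov
   function is F - 2 min_x F + 2 q, that is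
     f(x, y) + r1/2 |x - z|^2 - 2 D(y, z) + 2 q(z) + r2/2 |y - v|^2.
   One iteration decreases it by a positive combination of |x+ - x|^2, |y+ - y|^2,
   |y+ - v|^2 and beta |x+ - z|^2, up to a term beta E^2, where E is the distance
   between the minimizer for y+ and the minimizer x* at the maximizer of D(., z+).
   J is not concave in p, but the performance difference formula, s-rectangularity
   and the mismatch bound make it gradient dominated in p: stationary points of
   D(., z) yield saddle points, so x* is the proximal point of z+, and E^2 is
   bounded by the diameter of P times the step lengths.  Young's inequality leaves
   an error O(beta^2) per step, which is O(1) after K steps as beta ~ K^(-1/2);
   the best of K steps gives the rate K^(-1/4). *)

Require Import Defs.
From mathcomp Require Import all_boot all_order all_algebra.
From mathcomp Require Import all_classical all_reals all_analysis.
From mathcomp Require Import ring lra.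

Set Implicit Arguments.
Unset Strict Implicit.
Unset Printing Implicit Defensive.

Import Order.TTheory GRing.Theory Num.Theory.
Import numFieldNormedType.Exports.
Local Open Scope classical_set_scope.
Local Open Scope ring_scope.

(** * Euclidean geometry of matrices *)

(** The weight 2 has this origin: the ascent step in p raises F and min_x F by nearly the same
    first-order amount, as x+ is close to the minimizer; subtracting min_x F twice leaves one copy
    with the favourable sign, and 2 q pays for the motion of the anchor z. The obstacle is the bound
    on E. Gradient dominance is linear in the residual, while strong convexity in x yields E^2, so E
    is only of the order of the square root of a step length. This forces beta to shrink. The steps
    themselves come out as O(K^(-1/2)); only E and |x+ - z| are as large as O(K^(-1/4)). The square
    roots of the diameters appear because the range of the Lyapunov function and the accumulated
    error are linear in the diameters: kernels and policies have entries in [0, 1], so one factor of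
    every squared diameter is absorbed in a constant depending on S and A. No derivative of D or q
    is taken; comparing minimizers suffices. For J, [grad] differentiates with free entries, hence
    through matrices that are not stochastic. This is why resolvents are controlled by absolute row
    sums that may slightly exceed 1. *)

Section Euclidean.
Variables (R : realType) (m n : nat).
Implicit Types x y z : 'M[R]_(m, n).

Lemma innerC x y : inner x y = inner y x.
Proof. by apply: eq_bigr => i _; apply: eq_bigr => j _; rewrite mulrC. Qed.

Lemma innerDl x y z : inner (x + y) z = inner x z + inner y z.
Proof.
rewrite /inner -big_split; apply: eq_bigr => i _ /=.
by rewrite -big_split; apply: eq_bigr => j _ /=; rewrite mxE mulrDl.
Qed.

Lemma innerZl a x y : inner (a *: x) y = a * inner x y.
Proof.
rewrite /inner mulr_sumr; apply: eq_bigr => i _.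
by rewrite mulr_sumr; apply: eq_bigr => j _; rewrite mxE mulrA.
Qed.

Lemma innerNl x y : inner (- x) y = - inner x y.
Proof. by rewrite -scaleN1r innerZl mulN1r. Qed.

Lemma innerDr x y z : inner z (x + y) = inner z x + inner z y.
Proof. by rewrite innerC innerDl !(innerC z). Qed.

Lemma innerNr x y : inner x (- y) = - inner x y.
Proof. by rewrite innerC innerNl innerC. Qed.

Lemma innerZr a x y : inner x (a *: y) = a * inner x y.
Proof. by rewrite innerC innerZl innerC. Qed.

Lemma inner_ge0 x : 0 <= inner x x.
Proof.
by apply: sumr_ge0 => i _; apply: sumr_ge0 => j _; rewrite -expr2 sqr_ge0.
Qed.

Lemma sqr_frob x : frob x ^+ 2 = inner x x.
Proof.
rewrite /frob sqr_sqrtr; last first.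
  by apply: sumr_ge0 => i _; apply: sumr_ge0 => j _; apply: sqr_ge0.
by apply: eq_bigr => i _; apply: eq_bigr => j _; rewrite expr2.
Qed.

Lemma frob_ge0 x : 0 <= frob x.
Proof. exact: sqrtr_ge0. Qed.

Lemma frob_eq0 x : frob x = 0 -> x = 0.
Proof.
move=> x0; have : inner x x == 0 by rewrite -sqr_frob x0 expr0n.
rewrite psumr_eq0 => [/allP x1|i _]; last first.
  by apply: sumr_ge0 => j _; rewrite -expr2 sqr_ge0.
apply/matrixP => i j; rewrite mxE; have := x1 i (mem_index_enum i).
rewrite psumr_eq0 => [/allP /(_ j (mem_index_enum j))|k _]; last first.
  by rewrite -expr2 sqr_ge0.
by rewrite -expr2 sqrf_eq0 => /eqP.
Qed.

Lemma inner0l x : inner 0 x = 0.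
Proof. by rewrite -(scale0r x) innerZl mul0r. Qed.

Lemma cauchy_schwarz x y : inner x y <= frob x * frob y.
Proof.
have [x0|/eqP x0] := eqVneq (frob x) 0.
  by rewrite x0 (frob_eq0 x0) inner0l mul0r.
have [y0|/eqP y0] := eqVneq (frob y) 0.
  by rewrite y0 (frob_eq0 y0) innerC inner0l mulr0.
have xy0 : 0 < frob x * frob y.
  by rewrite mulr_gt0 // lt_def frob_ge0 andbT; apply/eqP.
have := inner_ge0 (frob y *: x - frob x *: y).
rewrite !(innerDl, innerDr, innerNl, innerNr, innerZl, innerZr) (innerC y x).
rewrite -!sqr_frob => H; rewrite -(ler_pM2l xy0); nra.
Qed.

Lemma frobN x : frob (- x) = frob x.
Proof.
by apply: (@pexpIrn _ 2); rewrite ?nnegrE ?frob_ge0 // !sqr_frob innerNl innerNr opprK.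
Qed.

Lemma frob_distC x y : frob (x - y) = frob (y - x).
Proof. by rewrite -frobN opprB. Qed.

Lemma frobZ a x : frob (a *: x) = `|a| * frob x.
Proof.
apply: (@pexpIrn _ 2); rewrite ?nnegrE ?mulr_ge0 ?frob_ge0 //.
by rewrite exprMn !sqr_frob innerZl innerZr mulrA -expr2 real_normK ?num_real.
Qed.

Lemma frob0 : frob (0 : 'M[R]_(m, n)) = 0.
Proof. by rewrite -(scale0r 0) frobZ normr0 mul0r. Qed.

Lemma ler_frobD x y : frob (x + y) <= frob x + frob y.
Proof.
have fx := frob_ge0 x; have fy := frob_ge0 y.
rewrite -(@ler_pXn2r _ 2) ?nnegrE ?addr_ge0 ?frob_ge0 //.
rewrite sqr_frob !(innerDl, innerDr) (innerC y x).
have := cauchy_schwarz x y; rewrite sqrrD -!sqr_frob; lra.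
Qed.

Lemma ler_frobB x y : frob (x - y) <= frob x + frob y.
Proof. by rewrite -(frobN y) ler_frobD. Qed.

Lemma ler_dist_frobD x y z : frob (x - z) <= frob (x - y) + frob (y - z).
Proof. by rewrite (_ : x - z = (x - y) + (y - z)) ?ler_frobD // subrKA. Qed.

Lemma cauchy_schwarz_ge x y : - (frob x * frob y) <= inner x y.
Proof. by rewrite -(frobN x) -[inner x y]opprK lerN2 -innerNl cauchy_schwarz. Qed.

Lemma sqr_frobD x y :
  frob (x + y) ^+ 2 = frob x ^+ 2 + 2 * inner x y + frob y ^+ 2.
Proof. by rewrite !sqr_frob innerDl !innerDr (innerC y x); ring. Qed.

Lemma sqr_frob_four_points (p q c d : 'M[R]_(m, n)) :
  frob (p - d) ^+ 2 - frob (p - c) ^+ 2 + frob (q - c) ^+ 2 - frob (q - d) ^+ 2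
  = 2 * inner (q - p) (d - c).
Proof.
rewrite !sqr_frob !(innerDl, innerDr, innerNl, innerNr).
by rewrite (innerC d p) (innerC c p) (innerC c q) (innerC d q); ring.
Qed.

End Euclidean.

(** * First-order optimality on convex sets *)

Definition segment_closed (R : realType) (m n : nat) (C : set 'M[R]_(m, n)) :=
  forall x y t, C x -> C y -> 0 <= t <= 1 -> C (x + t *: (y - x)).

(** First-order optimality without derivatives: for small [t] the linear term decides the sign. *)
Lemma linear_coeff_ge0 (R : realType) (a b : R) :
  (forall t, 0 < t <= 1 -> 0 <= t * a + t ^+ 2 * b) -> 0 <= a.
Proof.
move=> H; rewrite leNgt; apply/negP => a0.
have b0 : 0 <= `|b| by [].
have bb := ler_norm b.
(* This [t] makes a + t |b| equal to t a, which is negative. *)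
pose t := - a / (`|b| - a).
have d0 : 0 < `|b| - a by lra.
have te : t * (`|b| - a) = - a by rewrite /t mulfVK // gt_eqF.
have t0 : 0 < t by rewrite /t divr_gt0 //; lra.
have t1 : t <= 1 by rewrite /t ler_pdivrMr //; lra.
have /H : 0 < t <= 1 by rewrite t0 t1.
rewrite expr2 -mulrA -mulrDr pmulr_rge0 // => H1.
have : t * b <= t * `|b| by rewrite ler_pM2l.
nra.
Qed.

Section Projection.
Variables (R : realType) (m n : nat) (C : set 'M[R]_(m, n)).
Hypothesis C_seg : segment_closed C.

Lemma Proj_variational u w : Proj C u w ->
  forall v, C v -> inner (u - w) (v - w) <= 0.
Proof.
move=> [Cw wmin] v Cv; rewrite -oppr_ge0.
apply: (@linear_coeff_ge0 _ _ (inner (v - w) (v - w) / 2)) => t /andP[t0 t1].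
have /wmin : C (w + t *: (v - w)) by apply: C_seg => //; rewrite ltW.
rewrite -(@ler_pXn2r _ 2) ?nnegrE ?frob_ge0 // !sqr_frob.
rewrite (_ : w + t *: (v - w) - u = t *: (v - w) - (u - w)); last first.
  by apply/matrixP => i j; rewrite !mxE; ring.
rewrite -(opprB u w) innerNl innerNr opprK.
move: (v - w) (u - w) => a b.
rewrite !(innerDl, innerDr, innerNl, innerNr, innerZl, innerZr) (innerC a b).
by nra.
Qed.

End Projection.

(** * From the descent inequality to the rate *)

(** The induction on [K] carries the best index found so far. The sum starts at [k = 1] because the
    index asked for must be positive, hence [K.-1] terms. *)
Lemma telescope_pigeonhole (R : realType) (P w : nat -> R) (c : R) (K : nat) :
  (2 <= K)%N ->
  (forall k, (0 < k < K)%N -> w k <= P k - P k.+1 + c) ->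
  exists2 k, (0 < k < K)%N & K.-1%:R * w k <= P 1%N - P K + K.-1%:R * c.
Proof.
case: K => [//|[//|K]] _; elim: K => [|K IH] H.
  by exists 1%N => //; rewrite !mul1r H.
have [k /andP[k0 k1] Hk] := IH (fun k Hk => H k ltac:(by case/andP: Hk => -> /= /leqW)).
have Hn := H K.+2 ltac:(by rewrite /=).
have e : K.+2%:R = 1 + K.+1%:R :> R by rewrite -nat1r.
have K0 : 0 <= K.+1%:R :> R by rewrite ler0n.
rewrite -[K.+3.-1]/K.+2 e; move: Hk K0; rewrite -[K.+2.-1]/K.+1.
move: (K.+1%:R : R) => n Hk n0.
have [le_w|/ltW le_w] := leP (w k) (w K.+2).
  by exists k; [rewrite k0 ltnW|lra].
have nw : n * w K.+2 <= n * w k by rewrite ler_wpM2l.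
by exists K.+2; [rewrite ltnSn|lra].
Qed.

(** Young's inequality, once on [e * E] and then on each linear term produced by the bound on
    [E ^+ 2]. By [beta <= 1 / 15], a share 1/2 - 4/15 - 1/16 of [r1 * beta * e ^+ 2] survives; this
    exceeds the 1/8 that the terms in [m] can take, by [8 * m <= r1]. *)
Lemma weighted_step (R : realType) (m r1 beta C1 DY a b u e E dP : R) :
  0 < m -> 0 < r1 -> 0 < beta <= 1 / 15 -> 8 * m <= r1 ->
  0 <= C1 -> 0 <= DY -> 0 <= a -> 0 <= b -> 0 <= u -> 0 <= e ->
  E ^+ 2 <= C1 * (DY * (a + b + u + beta * e)) ->
  m * a ^+ 2 + m * b ^+ 2 + m * u ^+ 2 + r1 * beta / 2 * e ^+ 2
    - 2 * r1 * beta * e * (2 * beta * e + E) <= dP ->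
  m / 2 * (a ^+ 2 + b ^+ 2 + u ^+ 2 + beta * e ^+ 2)
    <= dP + 2 * (16 * (r1 * C1)) ^+ 2 / m * (beta ^+ 2 * DY ^+ 2).
Proof.
move=> m0 r0 /andP[b0 b1] mr C0 D0 a0 bb0 u0 e0 HE H.
(* The coefficient of the linear terms once [e * E] is split with weights 1/16 and 16. *)
set c := 16 * r1 * C1 * beta * DY.
have young s : c * s <= m / 2 * s ^+ 2 + c ^+ 2 / (2 * m).
  rewrite -subr_ge0 (_ : _ - _ = (m * s - c) ^+ 2 / (2 * m)).
    by rewrite divr_ge0 ?sqr_ge0 //; lra.
  by field; rewrite gt_eqF.
have e2 : 0 <= beta * e ^+ 2 by rewrite mulr_ge0 ?sqr_ge0 // ltW.
have K1 : 2 * r1 * beta * (e * E) <= r1 * beta * (e ^+ 2 / 16 + 16 * E ^+ 2).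
  rewrite (_ : 2 * r1 * beta * (e * E) = r1 * beta * (2 * (e * E))); last by ring.
  rewrite ler_pM2l ?mulr_gt0 //.
  have := sqr_ge0 (e / 4 - 4 * E); rewrite sqrrB; lra.
have K2 : 16 * r1 * beta * E ^+ 2 <= c * a + c * b + c * u + c * (beta * e).
  apply: le_trans (_ : 16 * r1 * beta * (C1 * (DY * (a + b + u + beta * e))) <= _).
    by rewrite ler_pM2l // !mulr_gt0 //; lra.
  by rewrite le_eqVlt; apply/orP; left; apply/eqP; rewrite /c; ring.
have K3 : r1 * (beta * (beta * e ^+ 2)) <= r1 * (1 / 15 * (beta * e ^+ 2)).
  by rewrite ler_pM2l // ler_wpM2r.
have K4 : m * (beta * e ^+ 2) <= r1 / 8 * (beta * e ^+ 2).
  by rewrite ler_wpM2r //; lra.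
have K5 : (beta * e) ^+ 2 <= beta * e ^+ 2.
  by rewrite exprMn ler_wpM2r ?sqr_ge0 // expr2 ger_pMl //; lra.
have K6 : m / 2 * (beta * e) ^+ 2 <= m / 2 * (beta * e ^+ 2).
  by rewrite ler_pM2l //; lra.
have -> : 2 * (16 * (r1 * C1)) ^+ 2 / m * (beta ^+ 2 * DY ^+ 2) = 4 * (c ^+ 2 / (2 * m)).
  by rewrite /c; field; rewrite gt_eqF.
have := young a; have := young b; have := young u; have := young (beta * e).
have K7 : 0 <= r1 * (beta * e ^+ 2) by rewrite mulr_ge0 // ltW.
lra.
Qed.

(** The factor [1 + C] stands for the square root of [C], which it dominates. *)
Lemma le_sqr_bound (R : realType) (a q C : R) :
  0 <= q -> 0 <= C -> a ^+ 2 <= C * q ^+ 2 -> a <= (1 + C) * q.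
Proof.
move=> q0 C0 H; rewrite leNgt; apply/negP => lt_a.
have : ((1 + C) * q) ^+ 2 < a ^+ 2.
  by rewrite ltr_pXn2r ?nnegrE // ?(le_trans _ (ltW lt_a)) // mulr_ge0 //; lra.
rewrite exprMn; have : 0 <= q ^+ 2 by exact: sqr_ge0.
nra.
Qed.

(** All runs are quantified inside, so that [C] is chosen before [K], [beta], the diameters and the
    iterates. [kap] is the fourth root of [K]; the uniform bound [BY] trades [DY ^+ 2] for a
    multiple of [DY]. *)
Definition rate_bound (R : realType) (m r1 C1 C2 BY c1 c2 C : R) : Prop :=
  forall (K : nat) (beta DX DY kap : R) (P a b u e E : nat -> R),
    (2 <= K)%N -> 0 < beta <= 1 / 15 -> 1 <= kap -> kap ^+ 4 = K%:R ->
    c1 / kap ^+ 2 <= beta <= c2 / kap ^+ 2 ->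
    0 <= DX -> 0 <= DY <= BY ->
    (forall k, [/\ 0 <= a k, 0 <= b k, 0 <= u k & 0 <= e k]) ->
    (forall k, (0 < k < K)%N ->
      E k ^+ 2 <= C1 * (DY * (a k + b k + u k + beta * e k))) ->
    (forall k, (0 < k < K)%N ->
      m * a k ^+ 2 + m * b k ^+ 2 + m * u k ^+ 2 + r1 * beta / 2 * e k ^+ 2
      - 2 * r1 * beta * e k * (2 * beta * e k + E k) <= P k - P k.+1) ->
    P 1%N - P K <= C2 * (DX + DY) ->
  let eps := C * (Num.sqrt DX + Num.sqrt DY) / kap in
  exists2 k, (0 < k < K)%N &
    [/\ a k <= eps, b k <= eps, u k <= eps, e k <= eps & E k <= eps].

(** With [t] the sum of the roots of the diameters, the weighted sum [W] at the best index is O(t^2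
    / K). Hence [a], [b], [u] are O(t / kap^2). The weight of [e] is only [beta], about 1 / kap^2,
    so [e] is O(t / kap); and [E ^+ 2], at most [DY] times step lengths, is O(t^2 / kap^2). *)
Lemma rate_of_weighted_sum (R : realType) (m r1 C1 C2 BY c1 c2 : R) :
  0 < m -> 0 < r1 -> 8 * m <= r1 -> 0 <= C1 -> 0 <= C2 -> 0 <= BY -> 0 < c1 ->
  exists2 C : R, 0 < C & rate_bound m r1 C1 C2 BY c1 c2 C.
Proof.
move=> m0 r0 mr C10 C20 BY0 c10.
pose C5 := 2 * (16 * (r1 * C1)) ^+ 2 / m.
pose C6 := 4 / m * (C2 + C5 * c2 ^+ 2 * BY).
have C50 : 0 <= C5 by apply: divr_ge0; [apply: mulr_ge0; rewrite ?sqr_ge0|exact: ltW].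
have C60 : 0 <= C6.
  have h : 0 <= C5 * c2 ^+ 2 * BY by rewrite mulr_ge0 // mulr_ge0 // sqr_ge0.
  by apply: mulr_ge0; [rewrite divr_ge0 // ltW|rewrite addr_ge0].
pose C7 := 4 * (1 + C6) * (1 + BY) * C1.
have C70 : 0 <= C7 by rewrite /C7 !mulr_ge0 //; lra.
have C6c : 0 <= C6 / c1 by rewrite divr_ge0 // ltW.
exists ((1 + C6) + (1 + C6 / c1) + (1 + C7)); first lra.
move=> K beta DX DY kap P a b u e E K2 b01 kap1 kapK /andP[bl bu] DX0 /andP[DY0 DYB]
  pos HE HP Prange /=.
have b0 : 0 < beta by case/andP: b01.
have K0 : 0 < K%:R :> R by rewrite ltr0n (leq_trans _ K2).
have k0 : 0 < kap by lra.
set T := DX + DY in Prange; have T0 : 0 <= T by rewrite addr_ge0.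
have bK : beta ^+ 2 * K%:R <= c2 ^+ 2.
  have : beta * kap ^+ 2 <= c2 by rewrite -ler_pdivlMr // exprn_gt0.
  rewrite -kapK (_ : beta ^+ 2 * kap ^+ 4 = (beta * kap ^+ 2) ^+ 2); last by ring.
  have bk0 : 0 <= beta * kap ^+ 2 by rewrite mulr_ge0 ?sqr_ge0 // ltW.
  by move=> h; rewrite ler_pXn2r // nnegrE // (le_trans _ h).
have [k k1 Hk] : exists2 k, (0 < k < K)%N &
    K.-1%:R * (m / 2 * (a k ^+ 2 + b k ^+ 2 + u k ^+ 2 + beta * e k ^+ 2))
    <= P 1%N - P K + K.-1%:R * (C5 * (beta ^+ 2 * DY ^+ 2)).
  apply: telescope_pigeonhole => // k k1; have [a0 bb0 u0 e0] := pos k.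
  exact: (weighted_step m0 r0 b01 mr C10 DY0 a0 bb0 u0 e0 (HE k k1) (HP k k1)).
exists k => //; have [a0 bb0 u0 e0] := pos k.
set W := a k ^+ 2 + b k ^+ 2 + u k ^+ 2 + beta * e k ^+ 2 in Hk.
have Kp : K.-1%:R = K%:R - 1 :> R by rewrite -subn1 natrB // (leq_trans _ K2).
have K2R : 2 <= K%:R :> R by rewrite ler_nat.
have W0 : 0 <= beta * e k ^+ 2 by rewrite mulr_ge0 ?sqr_ge0 // ltW.
have sa := sqr_ge0 (a k); have sb := sqr_ge0 (b k); have su := sqr_ge0 (u k).
have HW : W * K%:R <= C6 * T.
  have h1 : K.-1%:R * (C5 * (beta ^+ 2 * DY ^+ 2)) <= C5 * c2 ^+ 2 * BY * T.
    have -> : K.-1%:R * (C5 * (beta ^+ 2 * DY ^+ 2)) =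
       C5 * ((beta ^+ 2 * K.-1%:R) * (DY ^+ 2)) by ring.
    have -> : C5 * c2 ^+ 2 * BY * T = C5 * (c2 ^+ 2 * (BY * T)) by ring.
    rewrite ler_wpM2l // ler_pM ?sqr_ge0 //.
    - by rewrite mulr_ge0 ?sqr_ge0 ?ler0n.
    - by apply: le_trans bK; rewrite ler_wpM2l ?sqr_ge0 // Kp; lra.
    - by rewrite expr2 ler_pM // /T; lra.
  have h2 : K%:R / 2 * (m / 2 * W) <= K.-1%:R * (m / 2 * W).
    rewrite Kp ler_wpM2r; [by []|by rewrite mulr_ge0 // /W; lra|lra].
  have h3 : K%:R / 2 * (m / 2 * W) <= (C2 + C5 * c2 ^+ 2 * BY) * T by lra.
  have -> : W * K%:R = 4 / m * (K%:R / 2 * (m / 2 * W)) by field; rewrite gt_eqF.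
  by rewrite /C6 -(mulrA (4 / m)) ler_pM2l // divr_gt0.
have DXs : Num.sqrt DX ^+ 2 = DX by rewrite sqr_sqrtr.
have DYs : Num.sqrt DY ^+ 2 = DY by rewrite sqr_sqrtr.
move: DXs DYs (sqrtr_ge0 DX) (sqrtr_ge0 DY).
move: (Num.sqrt DX) (Num.sqrt DY) => dx dy DXs DYs dx0 dy0.
set t := dx + dy; have t0 : 0 <= t by rewrite addr_ge0.
have Tt : T <= t ^+ 2.
  by rewrite /T /t -DXs -DYs; have := mulr_ge0 dx0 dy0; rewrite sqrrD; lra.
pose q := t / kap; have q0 : 0 <= q by rewrite /q divr_ge0 // ltW.
have Hq : W <= C6 * (q / kap) ^+ 2.
  have -> : (q / kap) ^+ 2 = t ^+ 2 / K%:R by rewrite /q -kapK; field; rewrite gt_eqF.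
  by rewrite mulrA ler_pdivlMr // (le_trans HW) // ler_wpM2l.
have qk0 : 0 <= q / kap by rewrite divr_ge0 // ltW.
have qkq : q / kap <= q by rewrite ler_pdivrMr // ler_peMr.
have bnd s : s ^+ 2 <= W -> s <= (1 + C6) * (q / kap).
  by move=> h; apply: le_sqr_bound => //; exact: le_trans h Hq.
have Ha : a k <= (1 + C6) * (q / kap) by apply: bnd; rewrite /W; lra.
have Hb : b k <= (1 + C6) * (q / kap) by apply: bnd; rewrite /W; lra.
have Hu : u k <= (1 + C6) * (q / kap) by apply: bnd; rewrite /W; lra.
have Hbe : beta * e k <= (1 + C6) * (q / kap).
  apply: bnd; rewrite exprMn.
  have : beta ^+ 2 * e k ^+ 2 <= beta * e k ^+ 2.
    by rewrite ler_wpM2r ?sqr_ge0 // expr2 ger_pMl //; case/andP: b01; lra.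
  by rewrite /W; lra.
have He : e k <= (1 + C6 / c1) * q.
  apply: le_sqr_bound => //.
  rewrite mulrAC ler_pdivlMr //.
  have h1 : c1 / kap ^+ 2 * e k ^+ 2 <= beta * e k ^+ 2 by rewrite ler_wpM2r ?sqr_ge0.
  have h2 : c1 / kap ^+ 2 * e k ^+ 2 <= C6 * (q / kap) ^+ 2.
    by apply: le_trans Hq; rewrite /W; lra.
  have kk : 0 < kap ^+ 2 by rewrite exprn_gt0.
  have -> : e k ^+ 2 * c1 = kap ^+ 2 * (c1 / kap ^+ 2 * e k ^+ 2).
    by field; rewrite gt_eqF.
  have -> : C6 * q ^+ 2 = kap ^+ 2 * (C6 * (q / kap) ^+ 2) by field; rewrite gt_eqF.
  by rewrite ler_pM2l.
have HEk : E k <= (1 + C7) * q.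
  apply: le_sqr_bound => //; apply: le_trans (HE k k1) _.
  (* From [dy ^+ 2 = DY <= BY]. One factor [dy] of [DY] thus goes into the constant, and the other
     is at most [t]. *)
  have dyB : dy <= 1 + BY.
    by rewrite leNgt; apply/negP => h; nra.
  have -> : C7 * q ^+ 2 = C1 * (((1 + BY) * t) * (4 * ((1 + C6) * (q / kap)))).
    by rewrite /C7 /q; field; rewrite gt_eqF.
  rewrite ler_wpM2l // ler_pM //.
  - by rewrite !addr_ge0 ?mulr_ge0 // ltW.
  - by rewrite -DYs expr2 ler_pM // /t; lra.
  - lra.
have eE : ((1 + C6) + (1 + C6 / c1) + (1 + C7)) * t / kap =
  ((1 + C6) + (1 + C6 / c1) + (1 + C7)) * q by rewrite /q mulrA.
have z1 : 0 <= C6 * q by rewrite mulr_ge0.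
have z2 : 0 <= C6 / c1 * q by rewrite mulr_ge0.
have z3 : 0 <= C7 * q by rewrite mulr_ge0.
have z4 : (1 + C6) * (q / kap) <= (1 + C6) * q by rewrite ler_wpM2l //; lra.
rewrite eE; clear -Ha Hb Hu He HEk z1 z2 z3 z4 q0.
by split; lra.
Qed.

(** * Descent for the regularized min-max problem *)

Section MinMax.
Variables (R : realType) (m n m' n' : nat).
Local Notation V := 'M[R]_(m, n).
Local Notation W := 'M[R]_(m', n').
Variables (f : V -> W -> R) (gx : V -> W -> V) (gy : V -> W -> W).
Variables (X : set V) (Y : set W) (L l r1 r2 M : R).
Variables (xs : W -> V -> V) (ys : V -> W).
Implicit Types (x z : V) (y v : W).

Definition reg x y z := f x y + r1 / 2 * frob (x - z) ^+ 2.
Definition dual y z := reg (xs y z) y z.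
(* F - 2 min_x F + 2 q, simplified: the contributions of |y - v|^2 combine into
   the last term. *)
Definition potential x y z v :=
  reg x y z - 2 * dual y z + 2 * dual (ys z) z + r2 / 2 * frob (y - v) ^+ 2.

Hypothesis X_seg : segment_closed X.
Hypothesis Y_seg : segment_closed Y.
Hypotheses (L_gt0 : 0 < L) (l_gt0 : 0 < l) (r1_ge : 2 * L <= r1) (r2_ge : 2 * l <= r2).
Hypothesis gx_lip : forall x x' y y', X x -> X x' -> Y y -> Y y' ->
  frob (gx x y - gx x' y') <= L * (frob (x - x') + frob (y - y')).
Hypothesis gy_lip : forall x x' y y', X x -> X x' -> Y y -> Y y' ->
  frob (gy x y - gy x' y') <= l * (frob (x - x') + frob (y - y')).
Hypothesis fx_quad : forall x x' y, X x -> X x' -> Y y ->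
  `|f x' y - f x y - inner (gx x y) (x' - x)| <= L / 2 * frob (x' - x) ^+ 2.
Hypothesis fy_quad : forall x y y', X x -> Y y -> Y y' ->
  `|f x y' - f x y - inner (gy x y) (y' - y)| <= l / 2 * frob (y' - y) ^+ 2.
(** The substitute for concavity in [y]: near-stationary points are near-maximizers, at the price of
    the factor [M]. *)
Hypothesis f_dominated : forall x y B, X x -> Y y ->
  (forall y', Y y' -> inner (gy x y) (y' - y) <= B) ->
  forall y', Y y' -> f x y' - f x y <= M * B.
Hypothesis xsP : forall y z, Y y -> argmin X (fun x => reg x y z) (xs y z).
Hypothesis ysP : forall z, argmax Y (dual^~ z) (ys z).

(* [lra] does not see section hypotheses. *)
Ltac consts := move: (L_gt0) (l_gt0) (r1_ge) (r2_ge) => Lp lp r1p r2p.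

Let xsX y z : Y y -> X (xs y z). Proof. by move=> /(xsP z)[]. Qed.

Lemma reg_variational y z x : Y y -> X x ->
  0 <= inner (gx (xs y z) y + r1 *: (xs y z - z)) (x - xs y z).
Proof.
consts; move=> Yy Xx; have [Xs smin] := xsP z Yy; set s := xs y z in Xs smin *.
apply: (@linear_coeff_ge0 _ _ ((L + r1) / 2 * frob (x - s) ^+ 2)) => t /andP[t0 t1].
have Xt : X (s + t *: (x - s)) by apply: X_seg => //; rewrite ltW.
have := smin _ Xt; rewrite /reg.
have := fx_quad Xs Xt Yy.
have -> : s + t *: (x - s) - s = t *: (x - s) by rewrite addrC addKr.
have -> : s + t *: (x - s) - z = (s - z) + t *: (x - s) by rewrite addrAC.
move: (s - z) (x - s) => a b.
rewrite sqr_frobD !(innerDl, innerZl, innerZr) frobZ exprMn real_normK ?num_real //.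
rewrite ler_norml => /andP[_ H1 H2]; lra.
Qed.

(** [reg] is strongly convex in [x] with modulus [r1 - L]. Adding the two variational inequalities
    bounds [r1 - L] times the distance by r1 |z - z'| + L |y - y'|, and [2 * L <= r1] turns the
    quotients into 2 and 1. *)
Lemma xs_lipschitz y y' z z' : Y y -> Y y' ->
  frob (xs y z - xs y' z') <= frob (y - y') + 2 * frob (z - z').
Proof.
consts; move=> Yy Yy'.
have Xa := xsX z Yy; have Xb := xsX z' Yy'.
have H1 := reg_variational z Yy Xb.
have H2 := reg_variational z' Yy' Xa.
have H3 := gx_lip Xa Xb Yy Yy'.
set a := xs y z in Xa H1 H2 H3 *; set b := xs y' z' in Xb H1 H2 H3 *.
have H4 := cauchy_schwarz_ge (gx a y - gx b y') (a - b).
have H5 := cauchy_schwarz (z - z') (a - b).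
have fab := frob_ge0 (a - b).
have fz := frob_ge0 (z - z'); have fy := frob_ge0 (y - y').
have H6 : r1 * inner (a - b) (a - b) <=
    r1 * inner (z - z') (a - b) - inner (gx a y - gx b y') (a - b).
  suff -> : r1 * inner (z - z') (a - b) - inner (gx a y - gx b y') (a - b) =
     r1 * inner (a - b) (a - b) + inner (gx a y + r1 *: (a - z)) (b - a)
      + inner (gx b y' + r1 *: (b - z')) (a - b) by lra.
  by rewrite !(innerDl, innerDr, innerNl, innerNr, innerZl); ring.
have [->|fab0] := eqVneq (frob (a - b)) 0; first lra.
have {}fab : 0 < frob (a - b) by rewrite lt_def fab0.
have : r1 * frob (a - b) <= r1 * frob (z - z') + L * (frob (a - b) + frob (y - y')).
  rewrite -(ler_pM2r fab); rewrite -sqr_frob expr2 in H6.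
  have H7 : r1 * inner (z - z') (a - b) <= r1 * (frob (z - z') * frob (a - b)).
    by rewrite ler_pM2l //; lra.
  have H8 : frob (gx a y - gx b y') * frob (a - b) <=
      L * (frob (a - b) + frob (y - y')) * frob (a - b) by rewrite ler_pM2r.
  nra.
move=> H; nra.
Qed.

(** One half of Danskin's theorem, with no derivative of [dual]: the minimality of [xs y z] is
    tested against [xs y' z]. The quadratic bound on [f] costs l/2, and moving the gradient from
    [xs y' z] to [xs y z] costs [l] by [xs_lipschitz]; hence 3 l / 2. *)
Lemma dual_lower y y' z : Y y -> Y y' ->
  dual y z + inner (gy (xs y z) y) (y' - y) - 3 * l / 2 * frob (y' - y) ^+ 2
    <= dual y' z.
Proof.
consts; move=> Yy Yy'; rewrite /dual.
have Xs' := xsX z Yy'; have [Xs smin] := xsP z Yy.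
have H0 := xs_lipschitz z z Yy' Yy.
have := gy_lip Xs' Xs Yy Yy.
have := smin _ Xs'; rewrite /reg.
have := fy_quad Xs' Yy Yy'; rewrite ler_norml => /andP[+ _].
set s := xs y z in Xs H0 *; set s' := xs y' z in Xs' H0 *.
have := cauchy_schwarz_ge (gy s' y - gy s y) (y' - y).
rewrite [inner (gy s' y - _) _]innerDl innerNl.
move: H0; rewrite !subrr !frob0 mulr0 !addr0 => H0 H1 H2 H3 H4.
have fd := frob_ge0 (y' - y).
have H5 : frob (gy s' y - gy s y) * frob (y' - y) <= l * frob (y' - y) * frob (y' - y).
  rewrite ler_wpM2r // (le_trans H4) // ler_pM2l //.
rewrite expr2 in H2 *; lra.
Qed.

(** At a maximizer of [dual^~ z], [dual_lower] leaves no ascent direction for [f (xs (ys z) z)];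
    [f_dominated] with [B = 0] makes this stationarity global. *)
Lemma saddle z y : Y y -> f (xs (ys z) z) y <= f (xs (ys z) z) (ys z).
Proof.
move=> Yy; have [Yy0 ymax] := ysP z; set y0 := ys z in Yy0 ymax *.
rewrite -subr_le0 -(mulr0 M); apply: f_dominated => // [|y' Yy'].
  exact: xsX.
rewrite -oppr_ge0.
apply: (@linear_coeff_ge0 _ _ (3 * l / 2 * frob (y' - y0) ^+ 2)) => t /andP[t0 t1].
have Yt : Y (y0 + t *: (y' - y0)) by apply: Y_seg => //; rewrite ltW.
have := dual_lower z Yy0 Yt; have := ymax _ Yt => /=.
have -> : y0 + t *: (y' - y0) - y0 = t *: (y' - y0) by rewrite addrC addKr.
rewrite innerZr frobZ exprMn real_normK ?num_real //; lra.
Qed.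

(** Quadratic growth of [reg] around its minimizer for [ys z], against gradient dominance applied at
    [xs y z]. The first is quadratic in the distance and the second linear in [B], so that only the
    square of the error is controlled. *)
Lemma dual_error z y B : Y y ->
  (forall y', Y y' -> inner (gy (xs y z) y) (y' - y) <= B) ->
  (r1 - L) / 2 * frob (xs y z - xs (ys z) z) ^+ 2 <= M * B.
Proof.
consts; move=> Yy HB; have Xs := xsX z Yy; have [Yy0 ymax] := ysP z.
have H1 := f_dominated Xs Yy HB Yy0.
have Xw := xsX z Yy0; have H2 := reg_variational z Yy0 Xs.
have := fx_quad Xw Xs Yy0; rewrite ler_norml => /andP[H3 _].
have := ymax _ Yy; rewrite /= /dual /reg.
set s := xs y z in Xs H1 H2 H3 *.
set w := xs (ys z) z in Xw H1 H2 H3 *.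
have -> : s - z = (w - z) + (s - w) by rewrite [RHS]addrC addrA subrK.
move: H2 H3 H1; move: (s - w) (w - z) => a b.
rewrite sqr_frobD innerDl innerZl; lra.
Qed.

(** Strong monotonicity lets the length of a projected step bound the distance to the exact
    minimizer. The factor [2 * tau * r1 + 1] dominates [1 + tau * (L + r1)]; its quotient by
    [tau * (r1 - L)] is [kappa6]. *)
Lemma prox_error tau x y z x1 : 0 < tau -> X x -> Y y -> X x1 ->
  (forall u, X u -> inner (x - tau *: (gx x y + r1 *: (x - z)) - x1) (u - x1) <= 0) ->
  tau * (r1 - L) * frob (x1 - xs y z) <= (2 * tau * r1 + 1) * frob (x1 - x).
Proof.
consts; move=> tau0 Xx Yy Xx1 Hproj.
have Xs := xsX z Yy; have := Hproj _ Xs.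
have := reg_variational z Yy Xx1.
have G1 := gx_lip Xx1 Xs Yy Yy; have G2 := gx_lip Xx1 Xx Yy Yy.
set s := xs y z in Xs G1 G2 *.
have fa := frob_ge0 (x1 - s); have fb := frob_ge0 (x1 - x).
move: G1 G2; rewrite subrr frob0 !addr0 => G1 G2.
have I1 : frob (gx x1 y - gx s y) * frob (x1 - s) <= L * frob (x1 - s) * frob (x1 - s).
  by rewrite ler_wpM2r.
have I2 : frob (gx x1 y - gx x y) * frob (x1 - s) <= L * frob (x1 - x) * frob (x1 - s).
  by rewrite ler_wpM2r.
have C1 := cauchy_schwarz_ge (gx x1 y - gx s y) (x1 - s).
have C2 := cauchy_schwarz (gx x1 y - gx x y) (x1 - s).
have C3 := cauchy_schwarz (x1 - x) (x1 - s).
have C4 := cauchy_schwarz_ge (x1 - x) (x1 - s).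
have -> : inner (gx s y + r1 *: (s - z)) (x1 - s) =
   inner (gx x1 y) (x1 - s) - inner (gx x1 y - gx s y) (x1 - s)
   + r1 * inner (x1 - z) (x1 - s) - r1 * frob (x1 - s) ^+ 2.
  by rewrite sqr_frob !(innerDl, innerDr, innerNl, innerNr, innerZl); ring.
have -> : inner (x - tau *: (gx x y + r1 *: (x - z)) - x1) (s - x1) =
   inner (x1 - x) (x1 - s) + tau * (inner (gx x1 y) (x1 - s)
     - inner (gx x1 y - gx x y) (x1 - s) + r1 * inner (x1 - z) (x1 - s)
     - r1 * inner (x1 - x) (x1 - s)).
  by rewrite !(innerDl, innerDr, innerNl, innerNr, innerZl); ring.
move: C1 C2 C3 C4 I1 I2; move: (inner (gx x1 y) (x1 - s)) (inner (gx x1 y - gx s y) (x1 - s))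
  (inner (gx x1 y - gx x y) (x1 - s)) (inner (x1 - x) (x1 - s)) (inner (x1 - z) (x1 - s))
  (frob (gx x1 y - gx s y)) (frob (gx x1 y - gx x y)) => i1 i2 i3 i4 i5 n1 n2.
move: fa fb; set a := frob (x1 - s); set b := frob (x1 - x) => fa fb C1 C2 C3 C4 I1 I2 H1 H2.
have [->|a0] := eqVneq a 0; first by rewrite mulr0 mulr_ge0 //; nra.
have {}a0 : 0 < a by rewrite lt_def a0.
rewrite -(ler_pM2r a0).
have K1 : i3 <= L * b * a by lra.
have K2 : - (L * a * a) <= i2 by lra.
have K3 : tau * i3 <= tau * (L * b * a) by rewrite ler_pM2l.
have K4 : tau * - (L * a * a) <= tau * i2 by rewrite ler_pM2l.
have K5 : tau * r1 * i4 <= tau * r1 * (b * a) by rewrite ler_wpM2l // mulr_ge0 //; lra.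
have K6 : 0 <= tau * ( i1 - i2 + r1 * i5 - r1 * a ^+ 2) by rewrite mulr_ge0 // ltW.
have K7 : tau * (L * b * a) <= tau * (r1 * b * a).
  by rewrite ler_pM2l // -!mulrA ler_wpM2r ?mulr_ge0 //; lra.
rewrite expr2 in K6; lra.
Qed.

(** * One iteration of the abstract algorithm *)

Section Step.
Variables (tau sigma beta mu kappa : R) (x z x1 : V) (y v y1 : W).
Hypotheses (tau_gt0 : 0 < tau) (sigma_gt0 : 0 < sigma).
Hypotheses (beta01 : 0 < beta < 1) (mu01 : 0 < mu < 1).
Hypotheses (tau_le : tau * (L + r1) <= 4 / 3) (tau_le' : 6 * tau * l <= 1).
Hypotheses (kappaE : tau * (r1 - L) * kappa = 2 * tau * r1 + 1).
Hypotheses (sigma_le : 3 * l * sigma * kappa ^+ 2 <= 2).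
Hypotheses (sigma_le' : 6 * sigma * (2 * l + r2) <= 1).
Hypotheses (Xx : X x) (Yy : Y y) (Xx1 : X x1) (Yy1 : Y y1).
Hypothesis x1P : forall u, X u ->
  inner (x - tau *: (gx x y + r1 *: (x - z)) - x1) (u - x1) <= 0.
Hypothesis y1P : forall u, Y u ->
  inner (y + sigma *: (gy x1 y - r2 *: (y - v)) - y1) (u - y1) <= 0.
Let z1 := z + beta *: (x1 - z).
Let v1 := v + mu *: (y1 - v).
Let a := frob (x1 - x).
Let b := frob (y1 - y).
Let e := frob (x1 - z).
Let u := frob (y1 - v).
Let E := frob (xs y1 z1 - xs (ys z1) z1).

(** A projected step gains at least [(1 / tau - (L + r1) / 2) * a ^+ 2], and
    [tau * (L + r1) <= 4 / 3] keeps a third of [1 / tau]. *)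
Lemma primal_decrease : (3 * tau)^-1 * a ^+ 2 <= reg x y z - reg x1 y z.
Proof.
consts; move: (tau_gt0) (tau_le) => t0 t1.
have := x1P Xx; have := fx_quad Xx Xx1 Yy; rewrite ler_norml => /andP[_].
rewrite /reg; have -> : x1 - z = (x - z) + (x1 - x) by rewrite [RHS]addrC addrA subrK.
have -> : x - tau *: (gx x y + r1 *: (x - z)) - x1 =
   - (x1 - x) - tau *: (gx x y + r1 *: (x - z)).
  by apply/matrixP => i j; rewrite !mxE; ring.
rewrite -(opprB x1 x) /a (sqr_frobD (x - z)); move: (x1 - x) (x - z) => s w.
rewrite !(innerDl, innerNl, innerNr, innerZl) -sqr_frob => H1 H2.
have K : tau * (r1 + L) * frob s ^+ 2 <= 4 / 3 * frob s ^+ 2.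
  by rewrite ler_wpM2r ?sqr_ge0 // addrC.
rewrite ler_pdivrMl ?mulr_gt0 //.
have H3 : tau * (f x1 y - f x y - inner (gx x y) s) <= tau * (L / 2 * frob s ^+ 2).
  by rewrite ler_pM2l.
lra.
Qed.

Let Xs0 : X (xs y z). Proof. exact: xsX. Qed.

Lemma x1_near_xs : frob (x1 - xs y z) <= kappa * a.
Proof.
consts; move: (tau_gt0) => t0; have := prox_error tau_gt0 Xx Yy Xx1 x1P.
by rewrite -kappaE -[X in _ <= X]mulrA ler_pM2l // mulr_gt0 //; lra.
Qed.

(** The loss in [f x1] and twice the gain in [dual] involve nearly the same gradient, by
    [x1_near_xs], so one inner product survives with positive sign. Together with the anchor term it
    is at least [sigma^-1 * b ^+ 2] by the projection inequality. Replacing [xs y z] by [x1] is paid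
    for by half of the gain of [primal_decrease]. *)
Lemma dual_decrease :
  (8 * sigma)^-1 * b ^+ 2 - (6 * tau)^-1 * a ^+ 2 + r2 * mu / 2 * u ^+ 2 <=
  f x1 y - f x1 y1 + 2 * (dual y1 z - dual y z)
  + r2 / 2 * (frob (y - v) ^+ 2 - frob (y1 - v1) ^+ 2).
Proof.
consts; move: (tau_gt0) (sigma_gt0) (mu01) => t0 s0 /andP[m0 m1].
move: (tau_le') (sigma_le) (sigma_le') => t1 s1 s2.
have D1 := dual_lower z Yy Yy1.
have := fy_quad Xx1 Yy Yy1; rewrite ler_norml => /andP[_ D2].
have D3 : b ^+ 2 <= sigma * (inner (gy x1 y) (y1 - y) - r2 * inner (y - v) (y1 - y)).
  have := y1P Yy; rewrite /b sqr_frob -(opprB y1 y).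
  have -> : y + sigma *: (gy x1 y - r2 *: (y - v)) - y1 =
     - (y1 - y) + sigma *: (gy x1 y - r2 *: (y - v)).
    by apply/matrixP => i j; rewrite !mxE; ring.
  by move: (y1 - y) (y - v) => p q; rewrite !(innerDl, innerNl, innerNr, innerZl); lra.
have D4 : - (l * kappa * a * b) <= inner (gy (xs y z) y - gy x1 y) (y1 - y).
  apply: le_trans (cauchy_schwarz_ge _ _); rewrite lerN2 -/b.
  rewrite ler_wpM2r ?frob_ge0 //.
  have := gy_lip Xs0 Xx1 Yy Yy; rewrite subrr frob0 addr0 frob_distC => H.
  by apply: le_trans H _; rewrite -mulrA ler_pM2l // frob_distC x1_near_xs.
have D5 : frob (y1 - v1) = (1 - mu) * u.
  rewrite /u -[1 - mu]ger0_norm ?subr_ge0 ?ltW // -frobZ.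
  by congr frob; rewrite /v1; apply/matrixP => i j; rewrite !mxE; ring.
have D6 : u ^+ 2 = frob (y - v) ^+ 2 + 2 * inner (y - v) (y1 - y) + b ^+ 2.
  by rewrite -sqr_frobD /u; congr (frob _ ^+ 2); rewrite [RHS]addrC addrA subrK.
rewrite D5; have -> : frob (y - v) ^+ 2 = u ^+ 2 - 2 * inner (y - v) (y1 - y) - b ^+ 2.
  by rewrite D6; ring.
move: D1 D4; rewrite innerDl innerNl -/b.
move: (inner (gy (xs y z) y) _) D3 => i1.
move: (inner (gy x1 y) (y1 - y)) D2 (inner (y - v) (y1 - y)) => i2 + i3.
rewrite -/b => D2 D3 D1 D4.
have u0 : 0 <= u := frob_ge0 _.
have K1 : r2 * mu / 2 * u ^+ 2 <= r2 / 2 * (u ^+ 2 - ((1 - mu) * u) ^+ 2).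
  rewrite -subr_ge0 (_ : _ - _ = r2 / 2 * (mu * (1 - mu) * u ^+ 2)); last by field.
  by rewrite !mulr_ge0 //; lra.
have K2 : 2 * (kappa * a * b) <= kappa ^+ 2 * b ^+ 2 + a ^+ 2.
  by have := sqr_ge0 (kappa * b - a); lra.
have K3 : l * a ^+ 2 <= (6 * tau)^-1 * a ^+ 2.
  by rewrite ler_wpM2r ?sqr_ge0 // -[_^-1]mul1r ler_pdivlMr ?mulr_gt0 //; lra.
(* The three terms take at most 2/3, 3/16 (using [2 * l <= r2]) and 1/8 of [sigma^-1], in total
   47/48. *)
have K4 : l * kappa ^+ 2 * b ^+ 2 + (3 * l + l / 2 + r2 / 2) * b ^+ 2
     + (8 * sigma)^-1 * b ^+ 2 <= sigma^-1 * b ^+ 2.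
  rewrite -!mulrDl ler_wpM2r ?sqr_ge0 //.
  have L1 : l * kappa ^+ 2 <= 2 / 3 * sigma^-1 by rewrite ler_pdivlMr //; lra.
  have L2 : 2 * l + r2 <= 1 / 6 * sigma^-1 by rewrite ler_pdivlMr //; lra.
  by rewrite invfM; lra.
have K5 : sigma^-1 * b ^+ 2 <= i2 - r2 * i3 by rewrite ler_pdivrMl.
have K6 : l * (2 * (kappa * a * b)) <= l * (kappa ^+ 2 * b ^+ 2 + a ^+ 2).
  by rewrite ler_pM2l.
lra.
Qed.

(** Minimizers and maximizers are tested crosswise, so that all values of [f] cancel and the four
    squared distances left combine into [inner (w - p) (z1 - z)]. The distance from [w] to [p] is at
    most [2 * beta * e], for the motion of the minimizer with the anchor, plus [E]. *)
Lemma proximal_decrease :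
  - (r1 * beta * e * (2 * beta * e + E)) <=
  dual y1 z1 - dual y1 z + dual (ys z) z - dual (ys z1) z1.
Proof.
consts; move: (beta01) => /andP[b0 b1].
have [Yw ymax] := ysP z1; have [_ ymax0] := ysP z.
have [Xw wmin] := xsP z Yw; have [Xp pmin] := xsP z1 Yy1.
have [_ pmin0] := xsP z Yy1; have [_ wmin1] := xsP z1 Yw.
have H1 := pmin0 _ Xp; have H2 := ymax0 _ Yw; have H3 := wmin1 _ Xw.
have lip := xs_lipschitz z z1 Yw Yw; rewrite subrr frob0 add0r in lip.
have dz : frob (z1 - z) = beta * e.
  by rewrite /z1 addrC addKr frobZ ger0_norm // ltW.
have tri := ler_dist_frobD (xs (ys z1) z) (xs (ys z1) z1) (xs y1 z1).
rewrite (frob_distC (xs (ys z1) z1)) -/E in tri.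
have cs := cauchy_schwarz_ge (xs (ys z1) z - xs y1 z1) (z1 - z).
have lb : frob (xs (ys z1) z - xs y1 z1) * frob (z1 - z) <= (2 * beta * e + E) * (beta * e).
  rewrite dz ler_wpM2r //; first by rewrite mulr_ge0 ?frob_ge0 // ltW.
  by rewrite (frob_distC z) dz in lip; lra.
move: H1 H2 H3; rewrite /= /dual /reg.
set w := xs (ys z1) z in Xw cs lb *; set p := xs y1 z1 in Xp cs lb * => H1 H2 H3.
have sq : frob (p - z1) ^+ 2 - frob (p - z) ^+ 2 + frob (w - z) ^+ 2
   - frob (w - z1) ^+ 2 = 2 * inner (w - p) (z1 - z).
  exact: sqr_frob_four_points.
have K : r1 * (- ((2 * beta * e + E) * (beta * e))) <= r1 * inner (w - p) (z1 - z).
  by rewrite ler_pM2l; lra.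
have sq' : r1 / 2 * (frob (p - z1) ^+ 2 - frob (p - z) ^+ 2 + frob (w - z) ^+ 2
   - frob (w - z1) ^+ 2) = r1 * inner (w - p) (z1 - z) by rewrite sq; field.
lra.
Qed.

(** [proximal_decrease] counts twice, as [dual] does in the potential. The gain in [e ^+ 2] comes
    from the anchor moving towards [x1], which shrinks their distance by [1 - beta]. *)
Lemma potential_decrease :
  (6 * tau)^-1 * a ^+ 2 + (8 * sigma)^-1 * b ^+ 2 + r2 * mu / 2 * u ^+ 2
  + r1 * beta / 2 * e ^+ 2 - 2 * r1 * beta * e * (2 * beta * e + E)
  <= potential x y z v - potential x1 y1 z1 v1.
Proof.
consts; move: (beta01) => /andP[b0 b1].
have := primal_decrease; have := dual_decrease; have := proximal_decrease.
have D5 : frob (x1 - z1) = (1 - beta) * e.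
  rewrite /e -[1 - beta]ger0_norm ?subr_ge0 ?ltW // -frobZ.
  by congr frob; rewrite /z1; apply/matrixP => i j; rewrite !mxE; ring.
rewrite /potential /reg D5 -/e.
have K1 : r1 * beta / 2 * e ^+ 2 <= r1 / 2 * (e ^+ 2 - ((1 - beta) * e) ^+ 2).
  rewrite -subr_ge0 (_ : _ - _ = r1 / 2 * (beta * (1 - beta) * e ^+ 2)); last by field.
  by have e0 : 0 <= e := frob_ge0 _; rewrite !mulr_ge0 //; lra.
have -> : (3 * tau)^-1 * a ^+ 2 = 2 * ((6 * tau)^-1 * a ^+ 2).
  by rewrite mulrA; congr (_ * _); field; rewrite gt_eqF.
lra.
Qed.

Lemma xs1_near_x1 : frob (xs y1 z1 - x1) <= b + 2 * beta * e + kappa * a.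
Proof.
consts; move: (beta01) => /andP[b0 b1].
have dz : frob (z1 - z) = beta * e.
  by rewrite /z1 addrC addKr frobZ ger0_norm // ltW.
apply: le_trans (ler_dist_frobD _ (xs y z) _) _.
have := xs_lipschitz z1 z Yy1 Yy; have := x1_near_xs.
by rewrite frob_distC dz -/b; lra.
Qed.

Lemma proximal_residual :
  frob (xs (ys z1) z1 - z1) <= E + (b + 2 * beta * e + kappa * a) + e.
Proof.
move: (beta01) => /andP[b0 b1].
have De : frob (x1 - z1) = (1 - beta) * e.
  rewrite /e -[1 - beta]ger0_norm ?subr_ge0 ?ltW // -frobZ.
  by congr frob; rewrite /z1; apply/matrixP => i j; rewrite !mxE; ring.
have t1 := ler_dist_frobD (xs (ys z1) z1) (xs y1 z1) z1.
have t2 := ler_dist_frobD (xs y1 z1) x1 z1.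
have t3 := xs1_near_x1; rewrite (frob_distC (xs (ys z1) z1) (xs y1 z1)) -/E in t1.
have e0 : 0 <= beta * e by rewrite mulr_ge0 ?frob_ge0 // ltW.
lra.
Qed.

(** The normal vector is the projection residual divided by [tau]; added to the gradient, it leaves
    only gradient differences and step lengths. *)
Lemma pi_residual : exists2 g, normal_cone X x1 g &
  frob (gx x1 y1 + g) <= L * (a + b) + r1 * (a + e) + tau^-1 * a.
Proof.
consts; move: (tau_gt0) => t0.
exists (tau^-1 *: (x - tau *: (gx x y + r1 *: (x - z)) - x1)) => [w Xw|].
  by rewrite innerZl mulr_ge0_le0 ?invr_ge0 ?(ltW t0) // x1P.
have -> : gx x1 y1 + tau^-1 *: (x - tau *: (gx x y + r1 *: (x - z)) - x1) =
    (gx x1 y1 - gx x y) - r1 *: (x - z) + tau^-1 *: (x - x1).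
  by apply/matrixP => i j; rewrite !mxE; field; rewrite gt_eqF.
apply: le_trans (ler_frobD _ _) _; rewrite lerD //.
  apply: le_trans (ler_frobB _ _) _; rewrite lerD ?gx_lip //.
  rewrite frobZ ger0_norm; last lra.
  rewrite ler_wpM2l //; first lra.
  by apply: le_trans (ler_dist_frobD _ x1 _) _; rewrite frob_distC.
by rewrite frobZ ger0_norm ?invr_ge0 ?(ltW t0) // frob_distC.
Qed.

Lemma p_residual : exists2 g, normal_cone Y y1 g &
  frob (- gy x1 y1 + g) <= l * b + r2 * (b + u) + sigma^-1 * b.
Proof.
consts; move: (sigma_gt0) => s0.
exists (sigma^-1 *: (y + sigma *: (gy x1 y - r2 *: (y - v)) - y1)) => [w Yw|].
  by rewrite innerZl mulr_ge0_le0 ?invr_ge0 ?(ltW s0) // y1P.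
have -> : - gy x1 y1 + sigma^-1 *: (y + sigma *: (gy x1 y - r2 *: (y - v)) - y1) =
    (gy x1 y - gy x1 y1) - r2 *: (y - v) + sigma^-1 *: (y - y1).
  by apply/matrixP => i j; rewrite !mxE; field; rewrite gt_eqF.
apply: le_trans (ler_frobD _ _) _; rewrite lerD //.
  apply: le_trans (ler_frobB _ _) _; rewrite lerD //.
    by have := gy_lip Xx1 Xx1 Yy Yy1; rewrite subrr frob0 add0r (frob_distC y).
  rewrite frobZ ger0_norm; last lra.
  rewrite ler_wpM2l //; first lra.
  by apply: le_trans (ler_dist_frobD _ y1 _) _; rewrite frob_distC.
by rewrite frobZ ger0_norm ?invr_ge0 ?(ltW s0) // frob_distC.
Qed.

(** The projection inequality makes [y1] stationary for [dual^~ z1] up to step lengths, and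
    [dual_error] applies. The direction [y' - y1] is bounded by [DY] only, hence this factor. *)
Lemma dual_gap DY : (forall y', Y y' -> frob (y' - y1) <= DY) -> 0 <= DY ->
  (r1 - L) / 2 * E ^+ 2 <=
  M * (DY * (sigma^-1 * b + r2 * (b + u) + l * (2 * b + 2 * beta * e + kappa * a))).
Proof.
consts; move: (beta01) (sigma_gt0) => /andP[b0 b1] s0 HD D0.
apply: dual_error => // y' Yy'.
have Xh := xsX z1 Yy1.
have n1 := xs1_near_x1.
(* The gradient of [dual^~ z1] at [y1] minus the projection residual divided by [sigma]. *)
set g := r2 *: (y - v) - sigma^-1 *: (y - y1) + (gy (xs y1 z1) y1 - gy x1 y).
have H : inner (gy (xs y1 z1) y1) (y' - y1) <= inner g (y' - y1).
  have := y1P Yy'; rewrite -(pmulr_rle0 _ (_ : 0 < sigma^-1)) ?invr_gt0 //.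
  rewrite -innerZl (_ : sigma^-1 *: _ = sigma^-1 *: (y - y1) + gy x1 y - r2 *: (y - v)); last first.
    by apply/matrixP => i j; rewrite !mxE; field; rewrite gt_eqF.
  by rewrite /g !(innerDl, innerNl, innerZl); lra.
apply: le_trans H _; apply: le_trans (cauchy_schwarz _ _) _.
rewrite mulrC ler_pM ?frob_ge0 // ?HD //.
apply: le_trans (ler_frobD _ _) _; rewrite lerD //.
  apply: le_trans (ler_frobB _ _) _.
  have r20 : 0 <= r2 by lra.
  rewrite !frobZ (ger0_norm r20) ger0_norm ?invr_ge0 ?(ltW s0) // addrC.
  rewrite (frob_distC y y1) lerD2l ler_wpM2l //.
  apply: le_trans (ler_dist_frobD _ y1 _) _.
  by rewrite (frob_distC y).
have := gy_lip Xh Xx1 Yy1 Yy; rewrite -/b => H.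
by apply: le_trans H _; rewrite ler_pM2l //; lra.
Qed.

End Step.

Lemma potential_range (G DX DY : R) x y z v x' y' z' v' :
  (forall x1 x2 y0, X x1 -> X x2 -> Y y0 -> f x2 y0 - f x1 y0 <= G * frob (x2 - x1)) ->
  (forall x0 y1 y2, X x0 -> Y y1 -> Y y2 -> f x0 y2 - f x0 y1 <= G * frob (y2 - y1)) ->
  0 <= G -> (forall x1 x2, X x1 -> X x2 -> frob (x1 - x2) <= DX) ->
  (forall y1 y2, Y y1 -> Y y2 -> frob (y1 - y2) <= DY) ->
  X x -> Y y -> X z -> Y v -> Y y' -> X x' -> X z' ->
  potential x y z v - potential x' y' z' v' <=
    G * (DX + DY) + r1 * DX ^+ 2 + r2 * DY ^+ 2.
Proof.
consts; move=> Gx Gy G0 BX BY Xx Yy Xz Yv Yy' Xx' Xz'.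
have sqX x1 x2 : X x1 -> X x2 -> r1 / 2 * frob (x1 - x2) ^+ 2 <= r1 / 2 * DX ^+ 2.
  move=> X1 X2; rewrite ler_wpM2l //; first lra.
  by rewrite ler_pXn2r ?nnegrE ?frob_ge0 ?BX // (le_trans (frob_ge0 _) (BX _ _ X1 X2)).
have r1sq (w : V) : 0 <= r1 / 2 * frob w ^+ 2 by rewrite mulr_ge0 ?sqr_ge0 //; lra.
have r2sq (w : W) : 0 <= r2 / 2 * frob w ^+ 2 by rewrite mulr_ge0 ?sqr_ge0 //; lra.
have [Yw wmax] := ysP z; have [Yw' wmax'] := ysP z'.
have [Xs smin] := xsP z Yy; have [Xs' smin'] := xsP z' Yy'.
have [Xq qmin] := xsP z Yw; have [Xq' qmin'] := xsP z' Yw.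
have H1 : reg x y z - dual y z <= G * DX + r1 / 2 * DX ^+ 2.
  have h1 := Gx _ _ _ Xs Xx Yy; have h2 := sqX _ _ Xx Xz.
  have h3 : G * frob (x - xs y z) <= G * DX by rewrite ler_wpM2l ?BX.
  by have := r1sq (xs y z - z); rewrite /dual /reg; lra.
have H2 : dual (ys z) z - dual y z <= G * DY.
  have h1 := qmin _ Xs; have h2 := Gy _ _ _ Xs Yy Yw.
  have h3 : G * frob (ys z - y) <= G * DY by rewrite ler_wpM2l ?BY.
  by move: h1; rewrite /dual /reg; lra.
have H3 : dual (ys z) z - dual (ys z') z' <= r1 / 2 * DX ^+ 2.
  have h1 := wmax' _ Yw; have h2 := qmin _ Xq'; have h3 := sqX _ _ Xq' Xz.
  by have := r1sq (xs (ys z) z' - z'); move: h1 h2; rewrite /= /dual /reg; lra.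
have H4 : r2 / 2 * frob (y - v) ^+ 2 <= r2 / 2 * DY ^+ 2.
  rewrite ler_wpM2l //; first lra.
  by rewrite ler_pXn2r ?nnegrE ?frob_ge0 ?BY // (le_trans (frob_ge0 _) (BY _ _ Yy Yv)).
have H5 : 0 <= reg x' y' z' - dual y' z' by rewrite subr_ge0; exact: smin'.
have H6 : 0 <= dual (ys z') z' - dual y' z' by rewrite subr_ge0; exact: wmax'.
have H7 := r2sq (y' - v').
have H8 : 0 <= r2 / 2 * DY ^+ 2 by rewrite mulr_ge0 ?sqr_ge0 //; lra.
rewrite /potential; lra.
Qed.

(** * A whole run of the abstract algorithm *)

Section Run.
Variables (tau sigma beta mu kappa : R) (K : nat).
Variables (x z : nat -> V) (y v : nat -> W).
Hypotheses (tau_gt0 : 0 < tau) (sigma_gt0 : 0 < sigma).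
Hypotheses (beta_gt0 : 0 < beta) (beta_le : beta <= 1 / 15) (mu01 : 0 < mu < 1).
Hypotheses (tau_le : tau * (L + r1) <= 4 / 3) (tau_le' : 6 * tau * l <= 1).
Hypotheses (kappaE : tau * (r1 - L) * kappa = 2 * tau * r1 + 1).
Hypotheses (sigma_le : 3 * l * sigma * kappa ^+ 2 <= 2).
Hypotheses (sigma_le' : 6 * sigma * (2 * l + r2) <= 1).
Hypotheses (Xx0 : X (x 0%N)) (Yy0 : Y (y 0%N)) (zx0 : z 0%N = x 0%N) (vy0 : v 0%N = y 0%N).
Hypothesis run : forall k, (k < K)%N ->
  [/\ Proj X (x k - tau *: (gx (x k) (y k) + r1 *: (x k - z k))) (x k.+1),
      Proj Y (y k + sigma *: (gy (x k.+1) (y k) - r2 *: (y k - v k))) (y k.+1),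
      z k.+1 = z k + beta *: (x k.+1 - z k) &
      v k.+1 = v k + mu *: (y k.+1 - v k)].

Let beta01 : 0 < beta < 1.
Proof. by rewrite beta_gt0 /=; apply: le_lt_trans beta_le _; lra. Qed.

Lemma run_feasible k : (k <= K)%N -> [/\ X (x k), Y (y k), X (z k) & Y (v k)].
Proof.
have [b0 b1] := andP beta01; have [m0 m1] := andP mu01.
elim: k => [|k IH] kK; first by rewrite zx0 vy0.
have [Xx Yy Xz Yv] := IH (ltnW kK); have [[Xx1 _] [Yy1 _] -> ->] := run kK.
by split=> //; [apply: X_seg|apply: Y_seg] => //; rewrite !ltW.
Qed.

Variables (G DX DY BX BY m0 c1 c2 C kap : R).
Hypotheses (Gx : forall x1 x2 y0, X x1 -> X x2 -> Y y0 ->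
  f x2 y0 - f x1 y0 <= G * frob (x2 - x1)).
Hypotheses (Gy : forall x0 y1 y2, X x0 -> Y y1 -> Y y2 ->
  f x0 y2 - f x0 y1 <= G * frob (y2 - y1)).
Hypotheses (G_ge0 : 0 <= G).
Hypotheses (X_diam : forall x1 x2, X x1 -> X x2 -> frob (x1 - x2) <= DX).
Hypotheses (Y_diam : forall y1 y2, Y y1 -> Y y2 -> frob (y1 - y2) <= DY).
Hypotheses (DXB : 0 <= DX <= BX) (DYB : 0 <= DY <= BY) (M_ge0 : 0 <= M).
Hypotheses (m0_x : m0 <= (6 * tau)^-1) (m0_y : m0 <= (8 * sigma)^-1).
Hypotheses (m0_v : m0 <= r2 * mu / 2).
Hypotheses (K_ge2 : (2 <= K)%N) (kap_ge1 : 1 <= kap) (kapK : kap ^+ 4 = K%:R).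
Hypothesis beta_rate : c1 / kap ^+ 2 <= beta <= c2 / kap ^+ 2.

Definition gap_const := 2 * M * (sigma^-1 + r2 + 2 * l + l * kappa) / (r1 - L).
Definition range_const := G + r1 * BX + r2 * BY.
(** The three brackets bound the two gradient residuals and the proximal residual when all step
    lengths and [E] are at most 1. *)
Definition residual_const :=
  (2 * L + 2 * r1 + tau^-1) + (l + 2 * r2 + sigma^-1) + (5 + kappa).

Hypothesis C_rate : rate_bound m0 r1 gap_const range_const BY c1 c2 C.

Lemma run_stationary :
  let eps := residual_const * (C * (Num.sqrt DX + Num.sqrt DY) / kap) in
  exists2 k, (0 < k < K)%N &
  [/\ exists2 g, normal_cone X (x k.+1) g & frob (gx (x k.+1) (y k.+1) + g) <= eps,
      exists2 g, normal_cone Y (y k.+1) g & frob (- gy (x k.+1) (y k.+1) + g) <= eps &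
      frob (xs (ys (z k.+1)) (z k.+1) - z k.+1) <= eps].
Proof.
consts; move: (tau_gt0) (sigma_gt0) (beta_gt0) (beta_le) => t0 s0 b0 bl.
have ti : 0 < tau^-1 by rewrite invr_gt0.
have si : 0 < sigma^-1 by rewrite invr_gt0.
have k0 : 0 <= kappa.
  by rewrite -(@pmulr_rge0 _ (tau * (r1 - L))) ?kappaE ?mulr_gt0 //;
    [rewrite addr_ge0 ?mulr_ge0 //; lra|lra].
pose a k := frob (x k.+1 - x k); pose b k := frob (y k.+1 - y k).
pose u k := frob (y k.+1 - v k); pose e k := frob (x k.+1 - z k).
pose E k := frob (xs (y k.+1) (z k.+1) - xs (ys (z k.+1)) (z k.+1)).
pose P k := potential (x k) (y k) (z k) (v k).
have hE k : (0 < k < K)%N ->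
    E k ^+ 2 <= gap_const * (DY * (a k + b k + u k + beta * e k)).
  move=> /andP[_ kK]; have [Xx Yy Xz Yv] := run_feasible (ltnW kK).
  have [Xx1 Yy1 _ _] := run_feasible kK; have [px py ez ev] := run kK.
  have := dual_gap tau_gt0 sigma_gt0 beta01 kappaE Xx Yy Xx1 Yy1
    (Proj_variational X_seg px) (Proj_variational Y_seg py)
    (fun y' Yy' => Y_diam Yy' Yy1) (proj1 (andP DYB)).
  rewrite -ez -/(a k) -/(b k) -/(e k) -/(u k) -/(E k) => H.
  have D0 : 0 <= DY by case/andP: DYB.
  have [a0 bb0 u0 e0] : [/\ 0 <= a k, 0 <= b k, 0 <= u k & 0 <= e k].
    by split; exact: frob_ge0.
  have rL : 0 < r1 - L by lra.
  rewrite /gap_const mulrAC ler_pdivlMr //.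
  have H1 : sigma^-1 * b k + r2 * (b k + u k) +
     l * (2 * b k + 2 * beta * e k + kappa * a k) <=
     (sigma^-1 + r2 + 2 * l + l * kappa) * (a k + b k + u k + beta * e k).
    rewrite -subr_ge0 (_ : _ - _ = (sigma^-1 + r2 + 2 * l) * a k +
      l * kappa * b k + (sigma^-1 + 2 * l + l * kappa) * u k +
      (sigma^-1 + r2 + l * kappa) * (beta * e k)); last by ring.
    have lk : 0 <= l * kappa by rewrite mulr_ge0 // ltW.
    have be : 0 <= beta * e k by rewrite mulr_ge0 // ltW.
    by rewrite !addr_ge0 // mulr_ge0 //; lra.
  have := ler_wpM2l (mulr_ge0 M_ge0 D0) H1; rewrite -!mulrA in H *.
  by move=> H2; lra.
have hP k : (0 < k < K)%N ->
    m0 * a k ^+ 2 + m0 * b k ^+ 2 + m0 * u k ^+ 2 + r1 * beta / 2 * e k ^+ 2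
      - 2 * r1 * beta * e k * (2 * beta * e k + E k) <= P k - P k.+1.
  move=> /andP[_ kK]; have [Xx Yy Xz Yv] := run_feasible (ltnW kK).
  have [Xx1 Yy1 _ _] := run_feasible kK; have [px py ez ev] := run kK.
  have := potential_decrease tau_gt0 sigma_gt0 beta01 mu01 tau_le tau_le' kappaE
    sigma_le sigma_le' Xx Yy Xx1 Yy1
    (Proj_variational X_seg px) (Proj_variational Y_seg py).
  rewrite -ez -ev -/(P k) -/(P k.+1) -/(a k) -/(b k) -/(e k) -/(u k) -/(E k).
  apply: le_trans; rewrite !lerD2r.
  by rewrite !lerD // ler_wpM2r ?sqr_ge0.
have hR : P 1%N - P K <= range_const * (DX + DY).
  have [Xx Yy Xz Yv] := run_feasible (ltnW K_ge2).
  have [Xx1 Yy1 Xz1 _] := run_feasible (leqnn K).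
  apply: le_trans (potential_range _ Gx Gy G_ge0 X_diam Y_diam Xx Yy Xz Yv Yy1 Xx1 Xz1) _.
  move: (DXB) (DYB) (G_ge0) => /andP[DX0 DX1] /andP[DY0 DY1] G0; rewrite /range_const.
  have h1 : r1 * (DX * DX) <= r1 * (BX * DX) by rewrite ler_wpM2l ?ler_wpM2r //; lra.
  have h2 : r2 * (DY * DY) <= r2 * (BY * DY) by rewrite ler_wpM2l ?ler_wpM2r //; lra.
  have h3 : 0 <= r1 * (BX * DY) by rewrite !mulr_ge0 //; lra.
  have h4 : 0 <= r2 * (BY * DX) by rewrite !mulr_ge0 //; lra.
  rewrite !expr2; lra.
have hb : 0 < beta <= 1 / 15 by rewrite b0.
have hD : 0 <= DX by case/andP: DXB.
have hpos k : [/\ 0 <= a k, 0 <= b k, 0 <= u k & 0 <= e k].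
  by split; exact: frob_ge0.
(* One index serves all three residuals. *)
have [k k1 [ak bk uk ek Ek]] :=
  C_rate K_ge2 hb kap_ge1 kapK beta_rate hD DYB hpos hE hP hR.
exists k => //; case/andP: (k1) => _ kK.
have [Xx Yy Xz Yv] := run_feasible (ltnW kK).
have [Xx1 Yy1 _ _] := run_feasible kK; have [px py ez ev] := run kK.
move: ak bk uk ek Ek; rewrite /=; set eps := C * _ / kap => ak bk uk ek Ek.
have eps0 : 0 <= eps := le_trans (frob_ge0 _) ak.
have px' := Proj_variational X_seg px; have py' := Proj_variational Y_seg py.
have a1 : tau^-1 * a k <= tau^-1 * eps by rewrite ler_pM2l.
have b1 : sigma^-1 * b k <= sigma^-1 * eps by rewrite ler_pM2l.
have a2 : kappa * a k <= kappa * eps by rewrite ler_wpM2l.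
have a3 : L * (a k + b k) <= L * (2 * eps) by rewrite ler_pM2l //; lra.
have a4 : r1 * (a k + e k) <= r1 * (2 * eps) by rewrite ler_pM2l; lra.
have b2 : l * b k <= l * eps by rewrite ler_pM2l.
have b3 : r2 * (b k + u k) <= r2 * (2 * eps) by rewrite ler_pM2l; lra.
have e1 : beta * e k <= 1 * eps by rewrite ler_pM ?frob_ge0 //; lra.
have p1 : 0 <= L * eps by rewrite mulr_ge0 // ltW.
have p2 : 0 <= r1 * eps by rewrite mulr_ge0 //; lra.
have p3 : 0 <= tau^-1 * eps by rewrite mulr_ge0 // ltW.
have p4 : 0 <= l * eps by rewrite mulr_ge0 // ltW.
have p5 : 0 <= r2 * eps by rewrite mulr_ge0 //; lra.
have p6 : 0 <= sigma^-1 * eps by rewrite mulr_ge0 // ltW.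
have p7 : 0 <= kappa * eps by rewrite mulr_ge0.
split.
- have [g Ng Hg] := pi_residual tau_gt0 Xx Yy Xx1 Yy1 px'.
  exists g => //; apply: le_trans Hg _; rewrite -/(a k) -/(b k) -/(e k) /residual_const; lra.
- have [g Ng Hg] := p_residual sigma_gt0 Yy Xx1 Yy1 py'.
  exists g => //; apply: le_trans Hg _; rewrite -/(u k) -/(b k) /residual_const; lra.
- have := proximal_residual tau_gt0 beta01 kappaE Xx Yy Xx1 Yy1 px'.
  rewrite -ez -/(a k) -/(b k) -/(e k) -/(E k) => H; apply: le_trans H _.
  rewrite /residual_const; lra.
Qed.

End Run.
End MinMax.

(** The form in which compactness is used: all functions to be minimized are Lipschitz. It passes
    through isometries, so policies can be handled as flattened rows. *)
Definition has_lipschitz_argmin (R : realType) (m n : nat) (C : set 'M[R]_(m, n)) :=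
  forall (g : 'M[R]_(m, n) -> R) (G : R), 0 <= G ->
    (forall x y, C x -> C y -> g x - g y <= G * frob (x - y)) -> argmin C g !=set0.

(** * Existence of best responses and of dual maximizers *)

Section SaddleExistence.
Variables (R : realType) (m n m' n' : nat).
Local Notation V := 'M[R]_(m, n).
Local Notation W := 'M[R]_(m', n').
Variables (f : V -> W -> R) (X : set V) (Y : set W) (G B r1 : R).
Hypotheses (X_argmin : has_lipschitz_argmin X) (Y_argmin : has_lipschitz_argmin Y).
Hypotheses (X_neq0 : X !=set0) (G_ge0 : 0 <= G) (r1_ge0 : 0 <= r1).
Hypothesis X_bounded : forall x x', X x -> X x' -> frob (x - x') <= B.
Hypothesis f_lip_x : forall x1 x2 y, X x1 -> X x2 -> Y y ->
  f x2 y - f x1 y <= G * frob (x2 - x1).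
Hypothesis f_lip_y : forall x y1 y2, X x -> Y y1 -> Y y2 ->
  f x y2 - f x y1 <= G * frob (y2 - y1).

Lemma reg_argmin_neq0 y z : Y y -> argmin X (fun x => reg f r1 x y z) !=set0.
Proof.
move: (r1_ge0) (G_ge0) => r10 G0 Yy; have [x0 Hx0] := X_neq0.
(* [z] may lie outside [X]; [B1] bounds the distances from [X] to it and makes the squared distance
   Lipschitz on [X] with constant [2 * B1]. *)
pose B1 := B + frob (x0 - z).
have HB x : X x -> frob (x - z) <= B1.
  move=> Hx; apply: le_trans (ler_dist_frobD x x0 z) _.
  by rewrite lerD2r X_bounded.
have B0 : 0 <= B1 := le_trans (frob_ge0 _) (HB _ Hx0).
apply: (X_argmin (G := G + r1 * B1)) => [|x x' Hx Hx'].
  by rewrite addr_ge0 // mulr_ge0.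
have H1 := f_lip_x Hx' Hx Yy; have H2 := HB _ Hx; have H3 := HB _ Hx'.
have H4 := ler_dist_frobD x x' z.
have f0 := frob_ge0 (x - z); have f1 := frob_ge0 (x' - z); have f2 := frob_ge0 (x - x').
have H5 : frob (x - z) ^+ 2 - frob (x' - z) ^+ 2 <= 2 * B1 * frob (x - x').
  rewrite subr_sqr mulrC.
  apply: le_trans (_ : (frob (x - z) + frob (x' - z)) * frob (x - x') <= _).
    by rewrite ler_wpM2l ?addr_ge0 //; lra.
  by rewrite ler_wpM2r //; lra.
have H6 : r1 / 2 * (frob (x - z) ^+ 2 - frob (x' - z) ^+ 2) <=
    r1 / 2 * (2 * B1 * frob (x - x')) by rewrite ler_wpM2l // divr_ge0.
by rewrite /reg; lra.
Qed.

(** The default 0 is reached only when there is no minimizer, which is excluded for [y] in [Y]. *)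
Definition best_response y z := xget 0 (argmin X (fun x => reg f r1 x y z)).

Lemma best_responseP y z :
  Y y -> argmin X (fun x => reg f r1 x y z) (best_response y z).
Proof.
by move=> Yy; have [x Hx] := reg_argmin_neq0 z Yy; apply: (xgetPex 0); exists x.
Qed.

Definition dual_maximizer z := xget 0 (argmax Y ((dual f r1 best_response)^~ z)).

(** [dual] inherits the Lipschitz constant of [f] in [y], because the minimizer for one [y] can be
    tested at another. *)
Lemma dual_maximizerP z :
  argmax Y ((dual f r1 best_response)^~ z) (dual_maximizer z).
Proof.
apply: (xgetPex 0).
have [|y [Yy ymin]] := Y_argmin (g := fun y => - dual f r1 best_response y z) G_ge0.
  move=> y y' Yy Yy'; rewrite opprK addrC frob_distC.
  have [_ h1] := best_responseP z Yy'; have [Hx _] := best_responseP z Yy.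
  have := h1 _ Hx; have := f_lip_y Hx Yy Yy'; rewrite /dual /reg; lra.
by exists y; split => // y' Yy'; rewrite -lerN2 ymin.
Qed.

End SaddleExistence.

(** * Gradients along lines *)

Section Gradient.
Variables (R : realType) (m n : nat).
Local Notation V := 'M[R]_(m, n).
Implicit Types (f g : V -> R) (x d G H : V).

(** A first-order expansion with quadratic remainder along every line, including lines that leave
    the feasible set; the constants may depend on the direction. It determines [grad] and is stable
    under sums. *)
Definition has_grad f x G := forall d, exists h0 C : R, [/\ 0 < h0, 0 <= C &
  forall h, `|h| <= h0 -> `|f (h *: d + x) - f x - h * inner G d| <= C * h ^+ 2].

Lemma cvg_quotient (u : R -> R) (l h0 C : R) : 0 < h0 -> 0 <= C ->
  (forall h, `|h| <= h0 -> `|u h - h * l| <= C * h ^+ 2) ->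
  h^-1 *: u h @[h --> 0^'] --> l.
Proof.
move=> h00 C0 Hu; apply/cvgrPdist_le => e e0.
near=> h.
have h1 : h != 0 by near: h; exact: nbhs_dnbhs_neq.
have hh : `|h| <= Num.min h0 (e / (C + 1)).
  near: h; apply: dnbhs0_le; rewrite lt_min h00 /= divr_gt0 //; lra.
move: hh; rewrite le_min => /andP[hh0 hh1].
have hp : 0 < `|h| by rewrite normr_gt0.
rewrite -(ler_pM2l hp) -normrM mulrBr.
have -> : h * (h^-1 *: u h) = u h by rewrite -[_ *: _]/(_ * _) mulVKf.
rewrite distrC; apply: le_trans (Hu _ hh0) _.
have -> : h ^+ 2 = `|h| * `|h| by rewrite -expr2 real_normK ?num_real.
rewrite mulrCA ler_pM2l // (le_trans (ler_wpM2l C0 hh1)) //.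
rewrite mulrCA ger_pMr // ler_pdivrMr ?mul1r //; lra.
Unshelve. all: by end_near. Qed.

Lemma has_grad_cvg f x G d : has_grad f x G ->
  h^-1 *: (f (h *: d + x) - f x) @[h --> 0^'] --> inner G d.
Proof. by move=> /(_ d)[h0 [C [h00 C0 H]]]; apply: (@cvg_quotient _ _ h0 C). Qed.

Lemma inner_delta G i j : inner G (delta_mx i j) = G i j.
Proof.
rewrite /inner (bigD1 i) //= (bigD1 j) //= mxE !eqxx mulr1.
rewrite !big1 ?addr0 // => [i' ii'|j' jj'].
  by rewrite big1 // => j' _; rewrite mxE (negPf ii') mulr0.
by rewrite mxE (negPf jj') andbF mulr0.
Qed.

Lemma has_grad_grad f x G : has_grad f x G -> grad f x = G.
Proof.
move=> H; apply/matrixP => i j; rewrite mxE -[RHS]inner_delta.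
by apply/cvg_lim => //; exact: has_grad_cvg.
Qed.

Lemma has_grad_line f x d G t : has_grad f (x + t *: d) G ->
  is_derive t 1 (fun s : R => f (x + s *: d)) (inner G d).
Proof.
move=> /(has_grad_cvg (d := d)) H.
have {}H : h^-1 *: (f (x + (h *: (1 : R) + t) *: d) - f (x + t *: d)) @[h --> 0^'] --> inner G d.
  apply: cvg_trans H; apply: near_eq_cvg; near=> h.
  by congr (_ *: (f _ - _)); rewrite scalerDl -[h *: 1]/(h * 1) mulr1 addrCA.
by split; [apply/cvg_ex; exists (inner G d)|apply/cvg_lim].
Unshelve. all: by end_near. Qed.

(** The mean value theorem for [F], which is [f] along the segment minus the claimed model. Its
    derivative is nonpositive on the segment because the gradient is Lipschitz there. *)
Lemma has_grad_quad_upper f (C : set V) (gr : V -> V) (L : R) x x' :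
  segment_closed C -> 0 <= L -> (forall y, C y -> has_grad f y (gr y)) ->
  (forall y y', C y -> C y' -> frob (gr y - gr y') <= L * frob (y - y')) ->
  C x -> C x' ->
  f x' - f x - inner (gr x) (x' - x) <= L / 2 * frob (x' - x) ^+ 2.
Proof.
move=> Cseg L0 Hgr Hlip Cx Cx'; set d : V := x' - x.
pose c := inner (gr x) d; pose N := L * frob d ^+ 2.
pose F (s : R) := f (x + s *: d) + (- c * s + (- N / 2) * s ^+ 2).
have dF (s : R) : 0 <= s <= 1 ->
    is_derive s 1 F (inner (gr (x + s *: d)) d + (- c + (- N) * s)).
  move=> s01; apply: is_deriveD.
    by apply: has_grad_line; apply: Hgr; apply: Cseg.
  apply: is_derive_eq.
  by rewrite /GRing.scale /= ; field.
have cF : {within `[0, 1], continuous F}.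
  apply: derivable_within_continuous => s; rewrite in_itv /= => s01.
  by case: (dF s s01).
have dF' (s : R) : s \in `]0, 1[%R ->
    is_derive s 1 F (inner (gr (x + s *: d)) d + (- c + (- N) * s)).
  by rewrite in_itv /= => /andP[s0 s1]; apply: dF; rewrite !ltW.
have [s] := MVT ltr01 dF' cF.
rewrite in_itv /= => /andP[s0 s1].
have Cs : C (x + s *: d) by apply: Cseg => //; rewrite !ltW.
rewrite /F scale1r scale0r addr0 (_ : x + d = x'); last by rewrite addrC subrK.
have H1 := cauchy_schwarz (gr (x + s *: d) - gr x) d.
have := Hlip _ _ Cs Cx; rewrite addrAC subrr add0r frobZ ger0_norm ?(ltW s0) // => H2.
have fd := frob_ge0 d.
have H3 : frob (gr (x + s *: d) - gr x) * frob d <= L * (s * frob d) * frob d.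
  by rewrite ler_wpM2r.
have -> : L / 2 * frob d ^+ 2 = N / 2 by rewrite /N; ring.
have H4 : L * (s * frob d) * frob d = N * s by rewrite /N; ring.
move: H1; rewrite innerDl innerNl -/c => H1 H5.
lra.
Qed.

Lemma has_gradN f x G : has_grad f x G -> has_grad (fun y => - f y) x (- G).
Proof.
move=> H d; have [h0 [C [h00 C0 HC]]] := H d; exists h0, C; split => // h hh.
have {}HC := HC h hh; rewrite innerNl -normrN.
by apply: le_trans HC; rewrite le_eqVlt; apply/orP; left; apply/eqP; congr `|_|; ring.
Qed.

Lemma has_gradD f g x G H : has_grad f x G -> has_grad g x H ->
  has_grad (fun y => f y + g y) x (G + H).
Proof.
move=> Hf Hg d; have [h0 [C [h00 C0 HC]]] := Hf d; have [h1 [D [h10 D0 HD]]] := Hg d.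
exists (Num.min h0 h1), (C + D); split; rewrite ?addr_ge0 ?lt_min ?h00 // => h.
rewrite le_min => /andP[hh0 hh1]; rewrite innerDl mulrDl.
apply: le_trans (lerD (HC _ hh0) (HD _ hh1)); apply: le_trans (ler_normD _ _).
by rewrite le_eqVlt; apply/orP; left; apply/eqP; congr `|_|; ring.
Qed.

Lemma has_grad_cst a x : has_grad (fun=> a) x 0.
Proof.
move=> d; exists 1, 0; split => // h _.
by rewrite inner0l mulr0 subrr subr0 normr0 mul0r.
Qed.

Lemma has_grad_sqr_dist r a x :
  has_grad (fun y => r / 2 * frob (y - a) ^+ 2) x (r *: (x - a)).
Proof.
move=> d; exists 1, (`|r / 2 * frob d ^+ 2|); split => // h _.
rewrite -[X in _ <= _ * X]ger0_norm ?sqr_ge0 // -normrM.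
rewrite le_eqVlt; apply/orP; left; apply/eqP; congr `|_|.
rewrite -(addrA (h *: d)); move: (x - a) => b.
by rewrite !sqr_frob !(innerDl, innerDr, innerZl, innerZr) (innerC b d); field.
Qed.

Lemma has_grad_quad f (C : set V) (gr : V -> V) (L : R) x x' :
  segment_closed C -> 0 <= L -> (forall y, C y -> has_grad f y (gr y)) ->
  (forall y y', C y -> C y' -> frob (gr y - gr y') <= L * frob (y - y')) ->
  C x -> C x' ->
  `|f x' - f x - inner (gr x) (x' - x)| <= L / 2 * frob (x' - x) ^+ 2.
Proof.
move=> Cseg L0 Hgr Hlip Cx Cx'; rewrite ler_norml.
rewrite (has_grad_quad_upper Cseg L0 Hgr) // andbT lerNl.
have := has_grad_quad_upper (f := fun y => - f y) (gr := fun y => - gr y)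
  Cseg L0 _ _ Cx Cx'.
rewrite innerNl; set rhs := _ * _ ^+ 2 => H; apply: le_trans (H _ _) => {H}.
- by rewrite le_eqVlt; apply/orP; left; apply/eqP; ring.
- by move=> y Cy; apply/has_gradN/Hgr.
- by move=> y y' Cy Cy'; rewrite -opprD frobN Hlip.
Qed.

End Gradient.

(** * The resolvent of a transition matrix *)

Lemma cvg_sum_ord (R : realType) (I : finType) (u : I -> nat -> R) (l : I -> R) :
  (forall i, u i n @[n --> \oo] --> l i) ->
  \sum_i u i n @[n --> \oo] --> \sum_i l i.
Proof.
move=> H; elim: index_enum => [|i r IH].
  by rewrite big_nil; under eq_cvg do rewrite big_nil; exact: cvg_cst.
rewrite big_cons; under eq_cvg do rewrite big_cons.
exact: cvgD.
Qed.

Section Resolvent.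
Variables (R : realType) (k : nat) (gamma : R).
Hypothesis gamma_gt0 : 0 < gamma.
Implicit Types (P Q : 'M[R]_k) (th : R).

(** Absolute row sums, since perturbed transition matrices need not be nonnegative. Stochastic
    matrices have [th = 1]. *)
Definition row_norm_le P th := forall i, \sum_j `|P i j| <= th.

(** The Neumann series of the inverse of [1 - gamma P], taken entrywise to match the series defining
    [value]. *)
Definition resolvent P : 'M[R]_k :=
  \matrix_(i, j) limn (series (fun t => gamma ^+ t * (P ^+ t) i j)).

Lemma row_norm_exp P th t : 0 <= th -> row_norm_le P th ->
  row_norm_le (P ^+ t) (th ^+ t).
Proof.
move=> th0 HP; elim: t => [|t IH] i.
  rewrite (bigD1 i) //= !mxE eqxx normr1 big1 ?addr0 // => j ji.
  by rewrite !mxE eq_sym (negPf ji) normr0.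
rewrite exprS.
apply: le_trans (_ : \sum_j \sum_l `|P i l| * `|(P ^+ t) l j| <= _).
  apply: ler_sum => j _; rewrite mxE; apply: le_trans (ler_norm_sum _ _ _) _.
  by apply: ler_sum => l _; rewrite normrM.
rewrite exchange_big /= exprS.
apply: le_trans (_ : \sum_l `|P i l| * th ^+ t <= _).
  by apply: ler_sum => l _; rewrite -mulr_sumr ler_wpM2l.
by rewrite -mulr_suml ler_wpM2r // exprn_ge0.
Qed.

Lemma entry_exp_le P th t i j : 0 <= th -> row_norm_le P th ->
  `|(P ^+ t) i j| <= th ^+ t.
Proof.
move=> th0 /(row_norm_exp t th0)/(_ i); apply: le_trans.
by rewrite (bigD1 j) //= lerDl sumr_ge0.
Qed.

Section Convergence.
Variables (P : 'M[R]_k) (th : R).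
Hypotheses (th_ge0 : 0 <= th) (HP : row_norm_le P th) (gth : gamma * th < 1).

Let term i j t := gamma ^+ t * (P ^+ t) i j.

Lemma term_le i j t : `|term i j t| <= geometric 1 (gamma * th) t.
Proof.
rewrite /geometric /= mul1r normrM exprMn normrX (gtr0_norm gamma_gt0).
by rewrite ler_wpM2l ?exprn_ge0 ?(ltW gamma_gt0) // entry_exp_le.
Qed.

Let gth_norm : `|gamma * th| < 1.
Proof. by rewrite ger0_norm // mulr_ge0 // ltW. Qed.

Lemma cvg_normed_term i j : cvgn [normed series (term i j)].
Proof.
apply: (@series_le_cvg _ _ (geometric 1 (gamma * th))) => [t|t|t|].
- exact: normr_ge0.
- exact: le_trans (normr_ge0 _) (term_le i j t).
- exact: term_le.
- exact: is_cvg_geometric_series.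
Qed.

Lemma resolvent_cvg i j : series (term i j) n @[n --> \oo] --> resolvent P i j.
Proof. by rewrite mxE; apply: normed_cvg; apply: cvg_normed_term. Qed.

Lemma resolvent_le i j : `|resolvent P i j| <= (1 - gamma * th)^-1.
Proof.
have cn := @cvg_normed_term i j; have H := lim_series_norm cn.
rewrite mxE; apply: (le_trans H).
have := cvg_geometric_series (a := 1) gth_norm; rewrite mul1r => /cvg_lim <- //.
apply: lim_series_le; [exact: cn|exact: is_cvg_geometric_series|].
exact: term_le.
Qed.

Let partial n : 'M[R]_k := \matrix_(i, j) series (term i j) n.

Lemma partialS n : partial n.+1 = 1%:M + gamma *: (P *m partial n).
Proof.
apply/matrixP => i j; rewrite !mxE /series /= big_nat_recl //= {1}/term.
rewrite !expr0 mul1r mxE; congr (_ + _).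
rewrite mulr_sumr [RHS](_ : _ = \sum_l \sum_(0 <= t < n) gamma * (P i l * term l j t)).
  rewrite exchange_big /=; apply: eq_bigr => t _; rewrite /term !exprS mxE mulr_sumr.
  by apply: eq_bigr => l _; ring.
by apply: eq_bigr => l _; rewrite mxE /series /= !mulr_sumr.
Qed.

Lemma partialSr n : partial n.+1 = 1%:M + gamma *: (partial n *m P).
Proof.
apply/matrixP => i j; rewrite !mxE /series /= big_nat_recl //= {1}/term.
rewrite !expr0 mul1r mxE; congr (_ + _).
rewrite mulr_sumr [RHS](_ : _ = \sum_l \sum_(0 <= t < n) gamma * (term i l t * P l j)).
  rewrite exchange_big /=; apply: eq_bigr => t _; rewrite /term !exprSr mxE mulr_sumr.
  by apply: eq_bigr => l _; ring.
by apply: eq_bigr => l _; rewrite mxE /series /= !mulr_suml mulr_sumr.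
Qed.

(** The limit of the recursion for partial sums. This side gives the Bellman equation; [resolventEr]
    is the side needed for visits. *)
Lemma resolventE : resolvent P = 1%:M + gamma *: (P *m resolvent P).
Proof.
apply/matrixP => i j; have H := @resolvent_cvg i j.
have {}H : series (term i j) n.+1 @[n --> \oo] --> resolvent P i j.
  by rewrite cvg_shiftS.
apply: (cvg_unique _ H) => //.
have -> : (fun n => series (term i j) n.+1) =
    (fun n => (1%:M : 'M[R]_k) i j + gamma * \sum_l P i l * series (term l j) n).
  apply/funext => n; have /matrixP/(_ i j) := partialS n; rewrite !mxE => ->.
  by congr (_ + _ * _); apply: eq_bigr => l _; rewrite mxE.
have -> : (1%:M + gamma *: (P *m resolvent P)) i j =
    (1%:M : 'M[R]_k) i j + gamma * \sum_l P i l * resolvent P l j.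
  by rewrite [LHS]mxE; congr (_ + _); rewrite mxE [in LHS]mxE.
apply: cvgD; first exact: cvg_cst.
apply: cvgM; first exact: cvg_cst.
apply: cvg_sum_ord => l; apply: cvgM; [exact: cvg_cst|exact: resolvent_cvg].
Qed.

Lemma resolventEr : resolvent P = 1%:M + gamma *: (resolvent P *m P).
Proof.
apply/matrixP => i j; have H := @resolvent_cvg i j.
have {}H : series (term i j) n.+1 @[n --> \oo] --> resolvent P i j.
  by rewrite cvg_shiftS.
apply: (cvg_unique _ H) => //.
have -> : (fun n => series (term i j) n.+1) =
    (fun n => (1%:M : 'M[R]_k) i j + gamma * \sum_l series (term i l) n * P l j).
  apply/funext => n; have /matrixP/(_ i j) := partialSr n; rewrite !mxE => ->.
  by congr (_ + _ * _); apply: eq_bigr => l _; rewrite mxE.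
have -> : (1%:M + gamma *: (resolvent P *m P)) i j =
    (1%:M : 'M[R]_k) i j + gamma * \sum_l resolvent P i l * P l j.
  by rewrite [LHS]mxE; congr (_ + _); rewrite mxE [in LHS]mxE.
apply: cvgD; first exact: cvg_cst.
apply: cvgM; first exact: cvg_cst.
apply: cvg_sum_ord => l; apply: cvgM; [exact: resolvent_cvg|exact: cvg_cst].
Qed.

Lemma lim_series_resolvent_mul i (w : 'cV[R]_k) :
  limn (series (fun t => gamma ^+ t * ((P ^+ t) *m w) i 0)) = (resolvent P *m w) i 0.
Proof.
apply/cvg_lim => //; rewrite mxE.
have -> : series (fun t => gamma ^+ t * ((P ^+ t) *m w) i 0) =
    (fun n => \sum_j series (term i j) n * w j 0).
  apply/funext => n; rewrite /series /= (eq_bigr (fun t => \sum_j term i j t * w j 0)).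
    by rewrite exchange_big /=; apply: eq_bigr => j _; rewrite mulr_suml.
  by move=> t _; rewrite mxE mulr_sumr; apply: eq_bigr => j _; rewrite mulrA.
apply: cvg_sum_ord => j; apply: cvgM; [exact: resolvent_cvg|exact: cvg_cst].
Qed.

Hypothesis P_ge0 : forall i j, 0 <= P i j.

(** The term [t = 0] is the identity and the others are nonnegative. This later puts [rho] below the
    discounted visits. *)
Lemma resolvent_ge i j : (i == j)%:R <= resolvent P i j.
Proof.
have exp_ge0 t i' j' : 0 <= (P ^+ t) i' j'.
  elim: t i' j' => [|t IH] i' j'; first by rewrite mxE ler0n.
  by rewrite exprS mxE sumr_ge0 // => l _; rewrite mulr_ge0.
have H := @resolvent_cvg i j.
rewrite -(cvg_lim _ H) //; apply: limr_ge; first by apply/cvg_ex; exists (resolvent P i j).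
near=> n; have n0 : (0 < n)%N by near: n; exact: nbhs_infty_gt.
rewrite /series /= -(prednK n0) big_nat_recl //= {1}/term !expr0 mul1r mxE.
rewrite lerDl sumr_ge0 // => t _; apply: mulr_ge0 => //.
by rewrite exprn_ge0 // ltW // gamma_gt0.
Unshelve. all: by end_near. Qed.

End Convergence.
End Resolvent.

(** * Value functions and the performance difference *)

Lemma big_tuple0 (V : nmodType) (T : finType) (P : pred (seq T)) (F : seq T -> V) :
  \sum_(w : 0.-tuple T | P w) F w = if P [::] then F [::] else 0.
Proof.
case: ifP => P0; last by apply: big1 => w; rewrite tuple0 /= P0.
by rewrite (big_pred1 [tuple]) // => w; rewrite tuple0 /= P0 eqxx.
Qed.

Lemma big_tupleS (V : nmodType) (T : finType) {n} (P : pred (seq T)) (F : seq T -> V) :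
  \sum_(w : n.+1.-tuple T | P w) F w =
  \sum_x \sum_(w : n.-tuple T | P (x :: w)) F (x :: w).
Proof.
rewrite pair_big_dep /= (reindex (fun xw : T * n.-tuple T => [tuple of xw.1 :: xw.2])) //=.
exists (fun w : n.+1.-tuple T => (thead w, [tuple of behead w])) => [[x w] _|w _] /=.
  by rewrite theadE; congr pair; apply: val_inj.
by rewrite -tuple_eta.
Qed.

Section Slices.
Variables (R : realType) (nS nA : nat).
Implicit Types (x y : 'M[R]_(nS, nA * nS)) (s : 'I_nS).

Lemma sliceE x s a s' : slice x s a s' = x s (mxvec_index a s').
Proof. by rewrite !mxE. Qed.

Lemma sliceD x y s a s' : slice (x + y) s a s' = slice x s a s' + slice y s a s'.
Proof. by rewrite !sliceE mxE. Qed.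

Lemma sliceB x y s a s' : slice (x - y) s a s' = slice x s a s' - slice y s a s'.
Proof. by rewrite !sliceE !mxE. Qed.

Lemma sliceZ t x s a s' : slice (t *: x) s a s' = t * slice x s a s'.
Proof. by rewrite !sliceE mxE. Qed.

Lemma slice_sum (F : 'I_(nA * nS) -> R) :
  \sum_k F k = \sum_a \sum_s' F (mxvec_index a s').
Proof.
rewrite (reindex _ (curry_mxvec_bij nA nS)) /= pair_bigA /=.
by apply: eq_bigr => -[a s'].
Qed.

Lemma inner_slice x y :
  inner x y = \sum_s \sum_a \sum_s' slice x s a s' * slice y s a s'.
Proof.
apply: eq_bigr => s _; rewrite slice_sum; apply: eq_bigr => a _.
by apply: eq_bigr => s' _; rewrite !sliceE.
Qed.

Definition unslice (F : 'I_nS -> 'M[R]_(nA, nS)) : 'M[R]_(nS, nA * nS) :=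
  \matrix_(s, k) mxvec (F s) 0 k.

Lemma unsliceK F s : slice (unslice F) s = F s.
Proof. by apply/matrixP => a s'; rewrite sliceE mxE mxvecE. Qed.

End Slices.

Section MDP.
Variables (R : realType) (nS nA : nat) (gamma : R) (rho : 'rV[R]_nS).
Variable c : 'I_nS -> 'I_nA -> 'I_nS -> R.
Hypotheses (gamma01 : 0 < gamma < 1) (rho_simplex : simplex rho).
Implicit Types (pi : 'M[R]_(nS, nA)) (p : 'M[R]_(nS, nA * nS)) (v : 'cV[R]_nS).

Let gamma_gt0 : 0 < gamma. Proof. by case/andP: gamma01. Qed.

Definition transition pi p : 'M[R]_nS :=
  \matrix_(s, s') \sum_a pi s a * slice p s a s'.

Definition mean_cost pi p : 'cV[R]_nS :=
  \col_s \sum_a \sum_s' pi s a * slice p s a s' * c s a s'.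

(** Trajectories are cut after their first transition, where [traj_prob] recurses. *)
Lemma expected_costE pi p s t :
  expected_cost c pi p s t = ((transition pi p ^+ t) *m mean_cost pi p) s 0.
Proof.
elim: t s => [|t IH] s.
  rewrite /expected_cost (big_tuple0 predT (fun w => \sum_a \sum_s'
    traj_prob pi p s (rcons w (a, s')) * c (end_state s w) a s')) /=.
  rewrite expr0 mul1mx mxE; apply: eq_bigr => a _; apply: eq_bigr => s' _.
  by rewrite mulr1.
rewrite /expected_cost (big_tupleS predT (fun w => \sum_a \sum_s'
    traj_prob pi p s (rcons w (a, s')) * c (end_state s w) a s')) /=.
rewrite exprS -mulmxE -mulmxA mxE.
rewrite [RHS](eq_bigr (fun s1 => \sum_a pi s a * slice p s a s1 * expected_cost c pi p s1 t)).
  rewrite [RHS]exchange_big /= [RHS]pair_bigA /=; apply: eq_bigr => -[a s1] _ /=.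
  rewrite /expected_cost mulr_sumr; apply: eq_bigr => w _.
  rewrite mulr_sumr; apply: eq_bigr => a' _; rewrite mulr_sumr; apply: eq_bigr => s' _.
  by rewrite mulrA.
by move=> s1 _; rewrite -IH mxE mulr_suml.
Qed.

Lemma visit_probE pi p t s s' :
  visit_prob pi p t s s' = (transition pi p ^+ t) s s'.
Proof.
elim: t s => [|t IH] s.
  rewrite /visit_prob (big_tuple0 (fun w => end_state s w == s') (traj_prob pi p s)).
  by rewrite expr0 mxE /end_state /=; case: (s == s').
rewrite /visit_prob (big_tupleS (fun w => end_state s w == s') (traj_prob pi p s)) /=.
rewrite exprS mxE.
rewrite [RHS](eq_bigr (fun s1 => \sum_a pi s a * slice p s a s1 * visit_prob pi p t s1 s')).
  rewrite [RHS]exchange_big /= [RHS]pair_bigA /=; apply: eq_bigr => -[a s1] _ /=.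
  by rewrite /visit_prob mulr_sumr.
by move=> s1 _; rewrite -IH mxE mulr_suml.
Qed.

(** The occupancy without its factor [1 - gamma]. *)
Definition discounted_visits pi p : 'rV[R]_nS :=
  rho *m resolvent gamma (transition pi p).

Definition values pi p : 'cV[R]_nS :=
  resolvent gamma (transition pi p) *m mean_cost pi p.

(** Covers infeasible pairs near the feasible ones, at which derivatives of [J] evaluate it. *)
Definition contracting pi p th :=
  [/\ 0 <= th, gamma * th < 1 & row_norm_le (transition pi p) th].

Lemma J_E pi p th : contracting pi p th ->
  J gamma rho c pi p = (rho *m values pi p) 0 0.
Proof.
move=> [th0 gth H]; rewrite mxE; apply: eq_bigr => s _; congr (_ * _).
rewrite -(lim_series_resolvent_mul gamma_gt0 th0 H gth) /value.
by congr (limn (series _)); apply/funext => t; rewrite expected_costE.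
Qed.

Lemma occupancyE pi p th s' : contracting pi p th ->
  occupancy gamma rho pi p s' = (1 - gamma) * discounted_visits pi p 0 s'.
Proof.
move=> [th0 gth H]; rewrite /occupancy; congr (_ * _); rewrite mxE.
apply: eq_bigr => s _; apply/cvg_lim => //.
have -> : series (fun t => gamma ^+ t * rho 0 s * visit_prob pi p t s s') =
    fun n => rho 0 s * series (fun t => gamma ^+ t * (transition pi p ^+ t) s s') n.
  apply/funext => n; rewrite /series /= mulr_sumr; apply: eq_bigr => t _.
  by rewrite visit_probE mulrCA mulrA.
by apply: cvgM; [exact: cvg_cst|exact: (resolvent_cvg gamma_gt0 th0 H gth)].
Qed.

Definition backup pi p v : 'cV[R]_nS :=
  \col_s \sum_a \sum_s' pi s a * slice p s a s' * (c s a s' + gamma * v s' 0).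

Lemma backupE pi p v :
  backup pi p v = mean_cost pi p + gamma *: (transition pi p *m v).
Proof.
apply/matrixP => s j; rewrite !mxE (ord1 j) mulr_sumr.
rewrite [X in _ = _ + X](_ : _ = \sum_a \sum_s' pi s a * slice p s a s' * (gamma * v s' 0)).
  rewrite -big_split; apply: eq_bigr => a _; rewrite -big_split /=.
  by apply: eq_bigr => s' _; rewrite mulrDr.
rewrite exchange_big /=; apply: eq_bigr => s' _; rewrite mxE mulr_suml mulr_sumr.
by apply: eq_bigr => a _; ring.
Qed.

Lemma values_fixpoint pi p th : contracting pi p th ->
  backup pi p (values pi p) = values pi p.
Proof.
move=> [th0 gth H]; rewrite backupE /values.
rewrite [X in _ = X *m _](resolventE gamma_gt0 th0 H gth).
by rewrite mulmxDl mul1mx -scalemxAl mulmxA.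
Qed.

(* Performance difference: only the visits under the second pair occur, and the
   value function of the first. *)
Lemma J_sub pi p th pi' p' th' : contracting pi p th -> contracting pi' p' th' ->
  J gamma rho c pi' p' - J gamma rho c pi p =
  \sum_s discounted_visits pi' p' 0 s *
    (backup pi' p' (values pi p) - backup pi p (values pi p)) s 0.
Proof.
move=> H H'; rewrite (J_E H) (J_E H').
transitivity ((rho *m (values pi' p' - values pi p)) 0 0).
  by rewrite mulmxBr !mxE.
transitivity ((discounted_visits pi' p' *m
    (backup pi' p' (values pi p) - backup pi p (values pi p))) 0 0); last by rewrite mxE.
congr (_ 0 0); rewrite /discounted_visits -mulmxA; congr (_ *m _).
rewrite (values_fixpoint H) backupE mulmxBr mulmxDr -scalemxAr mulmxA -/(values pi' p').
case: H' => th0 gth H'.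
rewrite [X in _ = _ - X *m _](resolventEr gamma_gt0 th0 H' gth).
by rewrite mulmxDl mul1mx -scalemxAl opprD addrACA subrr addr0.
Qed.

End MDP.

(** * Perturbation of the resolvent *)

Section ResolventPerturbation.
Variables (R : realType) (k : nat) (gamma : R).
Hypothesis gamma01 : 0 < gamma < 1.
Implicit Types P Q : 'M[R]_k.

Let gamma_gt0 : 0 < gamma. Proof. by case/andP: gamma01. Qed.

(** The resolvent identity: the unit matrix is written through [P] to the right of the new resolvent
    and through [P'] to the left of the old one. *)
Lemma resolvent_sub P P' th th' : 0 <= th -> 0 <= th' ->
  gamma * th < 1 -> gamma * th' < 1 -> row_norm_le P th -> row_norm_le P' th' ->
  resolvent gamma P' - resolvent gamma P =
  gamma *: (resolvent gamma P' *m (P' - P) *m resolvent gamma P).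
Proof.
move=> th0 th0' g g' H H'.
have E := resolventE gamma_gt0 th0 H g; have E' := resolventEr gamma_gt0 th0' H' g'.
set N := resolvent gamma P in E *; set N' := resolvent gamma P' in E' *.
have {}E : N - gamma *: (P *m N) = 1%:M by rewrite {1}E addrK.
have {}E' : N' - gamma *: (N' *m P') = 1%:M by rewrite {1}E' addrK.
have -> : N' - N = N' *m (N - gamma *: (P *m N)) - (N' - gamma *: (N' *m P')) *m N.
  by rewrite E E' mulmx1 mul1mx.
rewrite !mulmxBr !mulmxBl -!scalemxAr -!scalemxAl mulmxA.
by rewrite opprB addrC addrA subrK -scalerBr.
Qed.

Lemma resolvent_perturb P Q : row_norm_le P 1 ->
  exists th h0 C : R, [/\ 0 <= th, gamma * th < 1, 0 < h0, 0 <= C &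
    forall h, `|h| <= h0 -> row_norm_le (h *: Q + P) th /\
      forall i j, `|resolvent gamma (h *: Q + P) i j - resolvent gamma P i j| <= C * `|h|].
Proof.
move=> HP; have [g0 g1] := andP gamma01.
(* Halfway between 1 and [gamma^-1]: room for a perturbation while the series still converges. *)
pose th := (1 + gamma^-1) / 2.
have gi : gamma * gamma^-1 = 1 by rewrite mulfV // gt_eqF.
have gi1 : 1 < gamma^-1 by rewrite invf_gt1.
have th1 : 1 < th by rewrite /th; lra.
have gth : gamma * th < 1 by rewrite /th mulrCA; nra.
pose cQ := \sum_i \sum_j `|Q i j|.
have row_cQ i : \sum_j `|Q i j| <= cQ.
  by rewrite /cQ [leRHS](bigD1 i) //= lerDl sumr_ge0 // => i' _; rewrite sumr_ge0.
have cQ0 : 0 <= cQ by apply: sumr_ge0 => i _; rewrite sumr_ge0.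
pose B := (1 - gamma * th)^-1.
have B0 : 0 <= B by rewrite invr_ge0; lra.
have th0 : 0 <= th by lra.
have HP' : row_norm_le P th by move=> i; apply: le_trans (HP i) _; exact: ltW.
exists th, ((th - 1) / (cQ + 1)), (gamma * (B * cQ * B)); split => //.
- by rewrite divr_gt0 //; lra.
- by rewrite !mulr_ge0 // ltW.
move=> h hh.
have Hh : row_norm_le (h *: Q + P) th.
  move=> i; apply: le_trans (_ : `|h| * \sum_j `|Q i j| + \sum_j `|P i j| <= _).
    rewrite mulr_sumr -big_split; apply: ler_sum => j _ /=.
    by rewrite !mxE -normrM ler_normD.
  have h1 : `|h| * \sum_j `|Q i j| <= `|h| * (cQ + 1).
    by rewrite ler_wpM2l // (le_trans (row_cQ i)) // lerDl.
  move: hh; rewrite ler_pdivlMr ?ltr_wpDl // => hh.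
  by have := HP i; lra.
split=> // i j.
have := resolvent_sub th0 th0 gth gth HP' Hh => /matrixP/(_ i j).
rewrite addrK mxE [(- _ : 'M[R]_k) i j]mxE => ->.
rewrite -scalemxAr -scalemxAl scalerA mxE normrM normrM (gtr0_norm g0).
rewrite [leRHS](_ : _ = gamma * `|h| * (B * cQ * B)); last by ring.
rewrite ler_wpM2l ?mulr_ge0 ?(ltW g0) // mxE; apply: le_trans (ler_norm_sum _ _ _) _.
apply: le_trans (_ : \sum_l \sum_i' B * `|Q i' l| * B <= _).
  apply: ler_sum => l _; rewrite normrM mxE.
  rewrite -mulr_suml ler_pM //.
    apply: le_trans (ler_norm_sum _ _ _) _; apply: ler_sum => i' _.
    by rewrite normrM ler_wpM2r // (resolvent_le gamma_gt0 th0 Hh gth).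
  exact: (resolvent_le gamma_gt0 th0 HP' gth).
rewrite exchange_big /= /cQ mulr_sumr mulr_suml.
by apply: ler_sum => i' _; rewrite mulr_sumr mulr_suml.
Qed.

End ResolventPerturbation.

Lemma frob_entry (R : realType) (m n : nat) (x : 'M[R]_(m, n)) i j : `|x i j| <= frob x.
Proof.
rewrite -(@ler_pXn2r _ 2) ?nnegrE ?frob_ge0 // real_normK ?num_real // sqr_frob.
rewrite /inner (bigD1 i) //= (bigD1 j) //= -expr2 -addrA lerDl addr_ge0 //.
  by apply: sumr_ge0 => j' _; rewrite -expr2 sqr_ge0.
by apply: sumr_ge0 => i' _; apply: sumr_ge0 => j' _; rewrite -expr2 sqr_ge0.
Qed.

(** * Bounds, gradients and gradient dominance of the objective *)

Section MDP.
Variables (R : realType) (nS nA : nat) (gamma : R) (rho : 'rV[R]_nS).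
Variable c : 'I_nS -> 'I_nA -> 'I_nS -> R.
Hypotheses (gamma01 : 0 < gamma < 1) (rho_simplex : simplex rho).
Hypothesis c01 : forall s a s', 0 <= c s a s' <= 1.
Implicit Types (pi : 'M[R]_(nS, nA)) (p : 'M[R]_(nS, nA * nS)) (v b : 'cV[R]_nS).

Local Notation J := (J gamma rho c).
Local Notation visits := (discounted_visits gamma rho).
Local Notation values := (values gamma c).
Local Notation backup := (backup gamma c).
Local Notation Pi := (policies R nS nA).
Local Notation Ker := (kernels R nS nA).

Let gamma_gt0 : 0 < gamma. Proof. by case/andP: gamma01. Qed.
Let gamma_lt1 : gamma < 1. Proof. by case/andP: gamma01. Qed.

Lemma policy_ge0 pi s a : Pi pi -> 0 <= pi s a.
Proof. by move=> /(_ s)[/(_ a)]; rewrite mxE. Qed.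

Lemma policy_sum pi s : Pi pi -> \sum_a pi s a = 1.
Proof. by move=> /(_ s)[_ <-]; apply: eq_bigr => a _; rewrite mxE. Qed.

Lemma policy_le1 pi s a : Pi pi -> pi s a <= 1.
Proof.
move=> H; rewrite -(policy_sum s H) (bigD1 a) //= lerDl.
by apply: sumr_ge0 => a' _; exact: policy_ge0.
Qed.

Lemma kernel_ge0 p s a s' : Ker p -> 0 <= slice p s a s'.
Proof. by move=> /(_ s a)[/(_ s')]; rewrite mxE. Qed.

Lemma kernel_sum p s a : Ker p -> \sum_s' slice p s a s' = 1.
Proof. by move=> /(_ s a)[_ <-]; apply: eq_bigr => s' _; rewrite [RHS]mxE. Qed.

Lemma kernel_le1 p s a s' : Ker p -> slice p s a s' <= 1.
Proof.
move=> H; rewrite -(kernel_sum s a H) (bigD1 s') //= lerDl.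
by apply: sumr_ge0 => s1 _; exact: kernel_ge0.
Qed.

Lemma transition_ge0 pi p s s' : Pi pi -> Ker p -> 0 <= transition pi p s s'.
Proof.
move=> H H'; rewrite mxE; apply: sumr_ge0 => a _.
by rewrite mulr_ge0 ?policy_ge0 ?kernel_ge0.
Qed.

Lemma transition_row_norm pi p : Pi pi -> Ker p -> row_norm_le (transition pi p) 1.
Proof.
move=> H H' s; rewrite (eq_bigr (fun s' => \sum_a pi s a * slice p s a s')).
  rewrite exchange_big /= (eq_bigr (fun a => pi s a)) ?policy_sum // => a _.
  by rewrite -mulr_sumr kernel_sum // mulr1.
by move=> s' _; rewrite ger0_norm ?transition_ge0 // mxE.
Qed.

Lemma contracting1 pi p : Pi pi -> Ker p -> contracting gamma pi p 1.
Proof. by move=> H H'; split; [|rewrite mulr1|exact: transition_row_norm]. Qed.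

Lemma rho_ge0 s : 0 <= rho 0 s. Proof. by case: rho_simplex. Qed.

Lemma rho_sum : \sum_s rho 0 s = 1. Proof. by case: rho_simplex. Qed.

Lemma visits_ge pi p s : Pi pi -> Ker p -> rho 0 s <= visits pi p 0 s.
Proof.
move=> H H'; have [th0 gth HP] := contracting1 H H'.
rewrite mxE (_ : rho 0 s = \sum_i rho 0 i * (i == s)%:R).
  apply: ler_sum => i _; rewrite ler_wpM2l ?rho_ge0 //.
  apply: (resolvent_ge gamma_gt0 th0 HP gth) => i' j'; exact: transition_ge0.
by rewrite (bigD1 s) //= eqxx mulr1 big1 ?addr0 // => i /negPf ->; rewrite mulr0.
Qed.

Lemma visits_ge0 pi p s : Pi pi -> Ker p -> 0 <= visits pi p 0 s.
Proof. by move=> H H'; apply: le_trans (visits_ge s H H'); exact: rho_ge0. Qed.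

Lemma resolvent_entry_le pi p i j : Pi pi -> Ker p ->
  `|resolvent gamma (transition pi p) i j| <= (1 - gamma)^-1.
Proof.
move=> H H'; have [th0 gth HP] := contracting1 H H'.
by have := resolvent_le gamma_gt0 th0 HP gth i j; rewrite mulr1.
Qed.

Lemma visits_le pi p s : Pi pi -> Ker p -> visits pi p 0 s <= (1 - gamma)^-1.
Proof.
move=> H H'; have -> : (1 - gamma)^-1 = \sum_i rho 0 i * (1 - gamma)^-1.
  by rewrite -mulr_suml rho_sum mul1r.
rewrite mxE; apply: ler_sum => i _.
rewrite ler_wpM2l ?rho_ge0 //.
by apply: le_trans (ler_norm _) _; exact: resolvent_entry_le.
Qed.

Lemma mean_cost_norm pi p s : Pi pi -> Ker p -> `|mean_cost c pi p s 0| <= 1.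
Proof.
move=> H H'; rewrite mxE ger0_norm; last first.
  apply: sumr_ge0 => a _; apply: sumr_ge0 => s' _.
  by rewrite !mulr_ge0 ?policy_ge0 ?kernel_ge0 //; case/andP: (c01 s a s').
rewrite -(policy_sum s H); apply: ler_sum => a _.
rewrite -[leRHS]mulr1 -(kernel_sum s a H') mulr_sumr; apply: ler_sum => s' _.
by rewrite ler_piMr ?mulr_ge0 ?policy_ge0 ?kernel_ge0 //; case/andP: (c01 s a s').
Qed.

Lemma values_norm pi p s : Pi pi -> Ker p -> `|values pi p s 0| <= nS%:R / (1 - gamma).
Proof.
move=> H H'; rewrite mxE; apply: le_trans (ler_norm_sum _ _ _) _.
apply: le_trans (_ : \sum_(i < nS) (1 - gamma)^-1 <= _).
  apply: ler_sum => i _; rewrite normrM -[leRHS]mulr1 ler_pM //.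
    exact: resolvent_entry_le.
  exact: mean_cost_norm.
by rewrite sumr_const card_ord mulr_natl.
Qed.

Definition cost_to_go_bound : R := 1 + nS%:R / (1 - gamma).

Lemma cost_to_go_bound_ge0 : 0 <= cost_to_go_bound.
Proof. by rewrite addr_ge0 ?divr_ge0 ?subr_ge0 ?(ltW gamma_lt1). Qed.

Lemma cost_to_go_norm pi p s a s' : Pi pi -> Ker p ->
  `|c s a s' + gamma * values pi p s' 0| <= cost_to_go_bound.
Proof.
move=> H H'; apply: le_trans (ler_normD _ _) _; apply: lerD.
  by case/andP: (c01 s a s') => ? ?; rewrite ger0_norm.
rewrite normrM (gtr0_norm gamma_gt0).
apply: le_trans (values_norm s' H H').
by rewrite ler_piMl // ltW.
Qed.

(** [pi] and [p] are arbitrary because one of them will be a difference; only the value vector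
    belongs to a feasible pair. *)
Lemma backup_norm pi p s pi' p' (m : R) : Pi pi' -> Ker p' -> 
  (forall a s', `|pi s a * slice p s a s'| <= m) ->
  `|backup pi p (values pi' p') s 0| <= nA%:R * nS%:R * cost_to_go_bound * m.
Proof.
move=> H H' Hm; rewrite mxE.
apply: le_trans (ler_norm_sum _ _ _) _.
apply: le_trans (_ : \sum_(a < nA) \sum_(s' < nS) cost_to_go_bound * m <= _).
  apply: ler_sum => a _; apply: le_trans (ler_norm_sum _ _ _) _.
  apply: ler_sum => s' _; rewrite normrM mulrC ler_pM //.
  exact: cost_to_go_norm.
rewrite !sumr_const !card_ord -mulrnA -[leLHS]mulr_natr natrM.
by rewrite le_eqVlt; apply/orP; left; apply/eqP; ring.
Qed.

Lemma backup_subl pi pi' p v : backup pi' p v - backup pi p v = backup (pi' - pi) p v.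
Proof.
apply/matrixP => s j; rewrite !mxE -sumrB; apply: eq_bigr => a _.
by rewrite -sumrB; apply: eq_bigr => s' _; rewrite !mxE; ring.
Qed.

Lemma backup_subr pi p p' v : backup pi p' v - backup pi p v = backup pi (p' - p) v.
Proof.
apply/matrixP => s j; rewrite !mxE -sumrB; apply: eq_bigr => a _.
by rewrite -sumrB; apply: eq_bigr => s' _; rewrite sliceB; ring.
Qed.

Lemma backupZl t pi p v : backup (t *: pi) p v = t *: backup pi p v.
Proof.
apply/matrixP => s j; rewrite !mxE mulr_sumr; apply: eq_bigr => a _.
by rewrite mulr_sumr; apply: eq_bigr => s' _; rewrite !mxE; ring.
Qed.

Lemma backupZr t pi p v : backup pi (t *: p) v = t *: backup pi p v.
Proof.
apply/matrixP => s j; rewrite !mxE mulr_sumr; apply: eq_bigr => a _.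
by rewrite mulr_sumr; apply: eq_bigr => s' _; rewrite sliceZ; ring.
Qed.

(** Independent of [c] and of the ambiguity set, as the final constant must be. *)
Definition J_lipschitz_const : R :=
  nS%:R * ((1 - gamma)^-1 * (nA%:R * nS%:R * cost_to_go_bound)).

Lemma J_lipschitz_const_ge0 : 0 <= J_lipschitz_const.
Proof.
have := cost_to_go_bound_ge0.
by move=> h; rewrite mulr_ge0 // mulr_ge0 ?mulr_ge0 // invr_ge0 subr_ge0 ltW.
Qed.

Lemma visits_backup_norm pi p b (m : R) : Pi pi -> Ker p -> 0 <= m ->
  (forall s, `|b s 0| <= nA%:R * nS%:R * cost_to_go_bound * m) ->
  `|\sum_s visits pi p 0 s * b s 0| <= J_lipschitz_const * m.
Proof.
move=> H H' m0 Hb; apply: le_trans (ler_norm_sum _ _ _) _.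
apply: le_trans (_ : \sum_(s < nS) (1 - gamma)^-1 *
  (nA%:R * nS%:R * cost_to_go_bound * m) <= _).
  apply: ler_sum => s _; rewrite normrM ler_pM //.
  by rewrite ger0_norm ?visits_ge0 ?visits_le.
rewrite sumr_const card_ord -[leLHS]mulr_natl /J_lipschitz_const.
by rewrite le_eqVlt; apply/orP; left; apply/eqP; ring.
Qed.

Lemma J_lipschitz_pi pi pi' p : Pi pi -> Pi pi' -> Ker p ->
  `|J pi' p - J pi p| <= J_lipschitz_const * frob (pi' - pi).
Proof.
move=> H H1 H'; rewrite (J_sub rho c gamma01 (contracting1 H H') (contracting1 H1 H')).
apply: visits_backup_norm; rewrite ?frob_ge0 // => s.
rewrite backup_subl; apply: backup_norm => // a s'.
rewrite normrM -[leRHS]mulr1 ler_pM ?frob_entry //.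
by rewrite ger0_norm ?kernel_ge0 ?kernel_le1.
Qed.

Lemma J_lipschitz_p pi p p' : Pi pi -> Ker p -> Ker p' ->
  `|J pi p' - J pi p| <= J_lipschitz_const * frob (p' - p).
Proof.
move=> H H' H1; rewrite (J_sub rho c gamma01 (contracting1 H H') (contracting1 H H1)).
apply: visits_backup_norm; rewrite ?frob_ge0 // => s.
rewrite backup_subr; apply: backup_norm => // a s'.
rewrite normrM -[leRHS]mul1r ler_pM //.
  by rewrite ger0_norm ?policy_ge0 ?policy_le1.
by rewrite sliceE frob_entry.
Qed.

(* Along a line in pi or in p both the transition matrix and the backup of a fixed
   value vector are affine. *)
Lemma J_perturb pi p (pih : R -> 'M[R]_(nS, nA)) (ph : R -> 'M[R]_(nS, nA * nS)) Q b :
  Pi pi -> Ker p ->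
  (forall h, transition (pih h) (ph h) = h *: Q + transition pi p) ->
  (forall h, backup (pih h) (ph h) (values pi p) - backup pi p (values pi p) = h *: b) ->
  exists h0 C : R, [/\ 0 < h0, 0 <= C & forall h, `|h| <= h0 ->
    `|J (pih h) (ph h) - J pi p - h * \sum_s visits pi p 0 s * b s 0| <= C * h ^+ 2].
Proof.
move=> H H' HQ Hb.
have [th [h0 [C [th0 gth h00 C0 HC]]]] :=
  resolvent_perturb gamma01 Q (transition_row_norm H H').
exists h0, (C * \sum_s `|b s 0|); split => //.
  by rewrite mulr_ge0 // sumr_ge0.
move=> h hh; have [Hrow Hres] := HC _ hh.
have Hc : contracting gamma (pih h) (ph h) th by split=> //; rewrite HQ.
rewrite (J_sub rho c gamma01 (contracting1 H H') Hc) Hb mulr_sumr -sumrB.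
apply: le_trans (ler_norm_sum _ _ _) _.
rewrite mulr_sumr mulr_suml; apply: ler_sum => s _.
rewrite [(h *: b) s 0]mxE.
rewrite (_ : _ - _ = (visits (pih h) (ph h) 0 s - visits pi p 0 s) * (h * b s 0)); last by ring.
rewrite normrM normrM.
rewrite (_ : C * _ * _ = (C * `|h|) * (`|h| * `|b s 0|)); last first.
  by rewrite -[h ^+ 2]real_normK ?num_real //; ring.
rewrite ler_wpM2r ?mulr_ge0 // !mxE -sumrB.
apply: le_trans (ler_norm_sum _ _ _) _.
rewrite -[leRHS]mul1r -rho_sum mulr_suml; apply: ler_sum => i _.
rewrite -mulrBr normrM (ger0_norm (rho_ge0 i)) ler_wpM2l ?rho_ge0 //.
by rewrite HQ; exact: Hres.
Qed.

(** The policy gradient theorem: discounted visits times action values. *)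
Definition grad_pi_J pi p : 'M[R]_(nS, nA) :=
  \matrix_(s, a) (visits pi p 0 s *
    \sum_s' slice p s a s' * (c s a s' + gamma * values pi p s' 0)).

Definition grad_p_J pi p : 'M[R]_(nS, nA * nS) :=
  unslice (fun s => \matrix_(a, s')
    (visits pi p 0 s * (pi s a * (c s a s' + gamma * values pi p s' 0)))).

(** The directional derivative is the performance difference with the visits frozen at the base
    pair. *)
Lemma inner_grad_pi_J pi p d :
  inner (grad_pi_J pi p) d = \sum_s visits pi p 0 s * backup d p (values pi p) s 0.
Proof.
apply: eq_bigr => s _; rewrite [backup _ _ _ s 0]mxE mulr_sumr; apply: eq_bigr => a _.
rewrite mxE -mulrA; congr (_ * _); rewrite mulr_suml; apply: eq_bigr => s' _.
by ring.
Qed.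

Lemma inner_grad_p_J pi p d :
  inner (grad_p_J pi p) d = \sum_s visits pi p 0 s * backup pi d (values pi p) s 0.
Proof.
rewrite inner_slice; apply: eq_bigr => s _; rewrite [backup _ _ _ s 0]mxE mulr_sumr.
apply: eq_bigr => a _; rewrite mulr_sumr; apply: eq_bigr => s' _.
by rewrite unsliceK mxE; ring.
Qed.

Lemma has_grad_J_pi pi p : Pi pi -> Ker p ->
  has_grad (fun q => J q p) pi (grad_pi_J pi p).
Proof.
move=> H H' d; rewrite inner_grad_pi_J.
apply: (@J_perturb pi p (fun h => h *: d + pi) (fun=> p) (transition d p)) => // h.
  apply/matrixP => s s'; rewrite !mxE mulr_sumr -big_split; apply: eq_bigr => a _ /=.
  by rewrite !mxE; ring.
by rewrite backup_subl addrK backupZl.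
Qed.

Lemma has_grad_J_p pi p : Pi pi -> Ker p -> has_grad (J pi) p (grad_p_J pi p).
Proof.
move=> H H' d; rewrite inner_grad_p_J.
apply: (@J_perturb pi p (fun=> pi) (fun h => h *: d + p) (transition pi d)) => // h.
  apply/matrixP => s s'; rewrite !mxE mulr_sumr -big_split; apply: eq_bigr => a _ /=.
  by rewrite sliceD sliceZ; ring.
by rewrite backup_subr addrK backupZr.
Qed.

Lemma mismatch_le pi p D s : Pi pi -> Ker p -> (mismatch gamma rho pi p <= D%:E)%E ->
  0 <= D /\ visits pi p 0 s <= D / (1 - gamma) * rho 0 s.
Proof.
move=> H H' HD.
have D0 : 0 <= D by rewrite -lee_fin; apply: le_trans HD; exact: bigmax_ge_id.
split => //; rewrite mulrAC ler_pdivlMr ?subr_gt0 // mulrC.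
rewrite -(occupancyE rho gamma01 _ (contracting1 H H')).
have := le_trans (le_bigmax (0 : \bar R)%E (fun s' =>
  `|(occupancy gamma rho pi p s')%:E / (rho 0 s')%:E|)%E s) HD.
rewrite (occupancyE rho gamma01 _ (contracting1 H H')).
have := visits_ge0 s H H'; move: (visits pi p 0 s) => o o0.
have o1 : 0 <= (1 - gamma) * o by rewrite mulr_ge0 // subr_ge0 ltW.
(* Where [rho] vanishes the ratio is infinite unless the occupancy vanishes too, so a finite [D]
   forces the latter. *)
rewrite inver; case: eqVneq => [->|r0].
  rewrite mulr0; have [->|o2] := eqVneq ((1 - gamma) * o) 0; first by [].
  by rewrite gt0_muley ?lte_fin ?lt_def ?o2 //= leye_eq.
have r1 : 0 < rho 0 s by rewrite lt_def r0 rho_ge0.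
by rewrite -EFinM /= lee_fin ger0_norm ?divr_ge0 ?rho_ge0 // ler_pdivrMr.
Qed.

Section Dominance.
Variables (P : set 'M[R]_(nS, nA * nS)) (D : R).
Hypotheses (P_ker : P `<=` Ker) (P_rect : s_rectangular P).
Hypothesis P_mismatch : bounded_mismatch gamma rho c P D.

(* By s-rectangularity the improving rows of the worst kernel can be selected
   one state at a time, so that every summand of the performance difference
   becomes nonnegative before the visits are exchanged. *)
Lemma J_dominated pi p B : Pi pi -> P p ->
  (forall p', P p' -> inner (grad_p_J pi p) (p' - p) <= B) ->
  forall p', P p' -> J pi p' - J pi p <= `|D| / (1 - gamma) * B.
Proof.
move=> H Pp HB p' Pp'.
have [ps [Pps pmax] Hmis] := P_mismatch.1 _ H.
have Kp := P_ker Pp; have Kps := P_ker Pps.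
apply: le_trans (_ : J pi ps - J pi p <= _); first by rewrite lerD2r pmax.
rewrite (J_sub rho c gamma01 (contracting1 H Kp) (contracting1 H Kps)).
set v := values pi p; set delta := fun s => backup pi (ps - p) v s 0.
pose q := unslice (fun s => if 0 <= delta s then slice ps s else slice p s).
have Pq : P q.
  have [P_ PE] := P_rect; rewrite PE /= => s; rewrite unsliceK.
  by move: Pp Pps; rewrite PE /= => Pp Pps; case: ifP.
have {HB} := HB _ Pq; rewrite inner_grad_p_J -/v => HB.
have [D0 _] : 0 <= D /\ True.
  have [s0 _|/= e] := pickP (fun s : 'I_nS => true).
    by have [? _] := mismatch_le s0 H Kps Hmis.
  by move: rho_sum; rewrite big_pred0 // => /eqP; rewrite eq_sym oner_eq0.
rewrite (ger0_norm D0); have Dg : 0 <= D / (1 - gamma) by rewrite divr_ge0 // subr_ge0 ltW.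
apply: le_trans (_ : D / (1 - gamma) *
   (\sum_s visits pi p 0 s * backup pi (q - p) v s 0) <= _); last by rewrite ler_wpM2l.
rewrite mulr_sumr; apply: ler_sum => s _.
(* [rho] is the pivot: visits under the worst kernel are at most [D / (1 - gamma)] times [rho], and
   [rho] is at most the visits under [p]. *)
have [_ vis] := mismatch_le s H Kps Hmis.
have vis0 := visits_ge0 s H Kps; have visr := visits_ge s H Kp.
rewrite backup_subr -/(delta s).
have -> : backup pi (q - p) v s 0 = if 0 <= delta s then delta s else 0.
  rewrite mxE; case: ifP => ds.
    rewrite /delta mxE; apply: eq_bigr => a _; apply: eq_bigr => s' _.
    by rewrite !sliceB unsliceK ds.
  rewrite big1 // => a _; rewrite big1 // => s' _.
  by rewrite sliceB unsliceK ds subrr mulr0 mul0r.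
case: ifP => [ds|/negbT]; last first.
  by rewrite -ltNge => ds; rewrite !mulr0 mulr_ge0_le0 // ltW.
rewrite mulrA ler_wpM2r // (le_trans vis) // ler_wpM2l //.
Qed.

End Dominance.
End MDP.

(** * Existence of minimizers *)

Section Compactness.
Variable R : realType.

Lemma frob_le_entries (m n : nat) (x : 'M[R]_(m, n)) (e : R) : 0 <= e ->
  (forall i j, `|x i j| <= e) -> frob x <= (1 + (m * n)%:R) * e.
Proof.
move=> e0 H; have mn0 : 0 <= (m * n)%:R :> R by rewrite ler0n.
rewrite -(@ler_pXn2r _ 2) ?nnegrE ?frob_ge0 ?mulr_ge0 ?addr_ge0 // exprMn sqr_frob.
apply: le_trans (_ : \sum_(i < m) \sum_(j < n) e ^+ 2 <= _).
  apply: ler_sum => i _; apply: ler_sum => j _; rewrite -expr2.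
  by rewrite -[x i j ^+ 2]real_normK ?num_real // ler_pXn2r ?nnegrE.
rewrite !sumr_const !card_ord -mulrnA mulnC -[leLHS]mulr_natl.
by rewrite ler_wpM2r ?sqr_ge0 //; nra.
Qed.

Lemma frob_le_norm (m n : nat) (x : 'M[R]_(m, n)) :
  frob x <= (1 + (m * n)%:R) * `|x|.
Proof.
apply: frob_le_entries => // i j; rewrite [leRHS]/Num.norm /= mx_normrE.
exact: (le_bigmax _ (fun ij : 'I_m * 'I_n => `|x ij.1 ij.2|) (i, j)).
Qed.

(** Continuity refers to the sup norm, hence the comparison constant [k]. *)
Lemma lipschitz_within_continuous (m n : nat) (C : set 'M[R]_(m, n))
    (f : 'M[R]_(m, n) -> R) (G : R) :
  0 <= G -> (forall x y, C x -> C y -> f x - f y <= G * frob (x - y)) ->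
  {within C, continuous f}.
Proof.
move=> G0 Hf; apply/subspace_continuousP => x Cx.
have [k k1 Hk] : exists2 k : R, 1 <= k & forall z : 'M[R]_(m, n), frob z <= k * `|z|.
  by exists (1 + (m * n)%:R) => [|z]; [rewrite lerDl ler0n|exact: frob_le_norm].
have Gk : 0 < (G + 1) * k by rewrite mulr_gt0 //; lra.
apply/cvgrPdist_le => e e0; rewrite near_withinE; near=> y => Cy.
apply: le_trans (_ : G * frob (x - y) <= _).
  by rewrite ler_norml lerNl opprB [in X in X && _]frob_distC !Hf.
have yx : `|x - y| <= e / ((G + 1) * k).
  by near: y; apply: cvgr_dist_le; [exact: cvg_id|exact: divr_gt0].
apply: le_trans (_ : (G + 1) * (k * `|x - y|) <= _).
  by rewrite ler_pM ?frob_ge0 ?Hk //; lra.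
by rewrite mulrA mulrC -ler_pdivlMr.
Unshelve. all: by end_near. Qed.

Lemma compact_lipschitz_argmin (m n : nat) (C : set 'M[R]_(m, n)) :
  C !=set0 -> compact C -> has_lipschitz_argmin C.
Proof.
move=> C0 cC f G G0 Hf.
have [x Cx xmin] := compact_EVT_min C0 cC (lipschitz_within_continuous G0 Hf).
by exists x; split=> [|y Cy]; [exact: set_mem|apply: xmin; exact: mem_set].
Qed.

Section Policies.
Variables nS nA : nat.

Lemma policies_segment : segment_closed (policies R nS nA).
Proof.
move=> x y t Hx Hy /andP[t0 t1] s; split=> [a|].
  rewrite !mxE (_ : _ + _ = (1 - t) * x s a + t * y s a); last by ring.
  by rewrite addr_ge0 // mulr_ge0 ?policy_ge0 // subr_ge0.
rewrite (eq_bigr (fun a => (1 - t) * x s a + t * y s a)).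
  by rewrite big_split /= -!mulr_sumr !policy_sum // !mulr1 subrK.
by move=> a _; rewrite !mxE; ring.
Qed.

Lemma policies_bounded x y : policies R nS nA x -> policies R nS nA y ->
  frob (x - y) <= 1 + (nS * nA)%:R.
Proof.
move=> Hx Hy; rewrite -[leRHS]mulr1; apply: frob_le_entries => // s a.
have := policy_ge0 s a Hx; have := policy_ge0 s a Hy.
have := policy_le1 s a Hx; have := policy_le1 s a Hy.
by rewrite !mxE ler_norml; lra.
Qed.

Lemma kernels_bounded x y : kernels R nS nA x -> kernels R nS nA y ->
  frob (x - y) <= 1 + (nS * (nA * nS))%:R.
Proof.
move=> Hx Hy; rewrite -[leRHS]mulr1; apply: frob_le_entries => // s k.
case/mxvec_indexP: k => a s'; rewrite mxE [(- y) _ _]mxE -!sliceE.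
have := kernel_ge0 s a s' Hx; have := kernel_ge0 s a s' Hy.
have := kernel_le1 s a s' Hx; have := kernel_le1 s a s' Hy.
by rewrite ler_norml; lra.
Qed.

Lemma compact_policies_rows :
  compact [set v : 'rV[R]_(nS * nA) | policies R nS nA (vec_mx v)].
Proof.
apply: (@subclosed_compact _ _
  [set v : 'rV[R]_(nS * nA) | forall i, `[0, 1]%classic (v ord0 i)]).
- rewrite (_ : mkset _ =
    (\bigcap_(i in [set: 'I_(nS * nA)]) ((fun v : 'rV[R]_(nS * nA) => v 0 i) @^-1` [set x | 0 <= x]))
    `&` (\bigcap_(s in [set: 'I_nS])
      ((fun v : 'rV[R]_(nS * nA) => \sum_a v 0 (mxvec_index s a)) @^-1` [set x | x = 1]))).
    apply: closedI; apply: closed_bigI => i _; apply: preimage_closed.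
    + by move=> x _; exact: coord_continuous.
    + exact: closed_ge.
    + move=> x _; apply: continuous_big => [|a _]; first exact: add_continuous.
      exact: coord_continuous.
    + exact: closed_eq.
  apply/seteqP; split=> v /=.
    move=> H; split=> [k _|s _] /=.
      by case/mxvec_indexP: k => s a; have := policy_ge0 s a H; rewrite mxE.
    by rewrite -[RHS](policy_sum s H); apply: eq_bigr => a _; rewrite mxE.
  move=> [H0 H1] s; split=> [a|].
    by rewrite !mxE; exact: H0.
  by rewrite -[RHS](H1 s I); apply: eq_bigr => a _; rewrite !mxE.
- by apply: (@rV_compact R _ (fun=> `[0, 1]%classic)) => _; exact: segment_compact.
- move=> v H k /=; case/mxvec_indexP: k => s a; rewrite in_itv /=.
  by have := policy_ge0 s a H; have := policy_le1 s a H; rewrite mxE => -> ->.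
Qed.

(** [vec_mx] is an isometry for the Frobenius norm, so the problem moves to the compact set of
    flattened policies. *)
Lemma policies_lipschitz_argmin :
  policies R nS nA !=set0 -> has_lipschitz_argmin (policies R nS nA).
Proof.
move=> [x0 Hx0] f G G0 Hf.
have frob_vec (v : 'rV[R]_(nS * nA)) : frob (vec_mx v) = frob v.
  congr Num.sqrt; rewrite big_ord1 (reindex _ (curry_mxvec_bij nS nA)) /= pair_bigA /=.
  by apply: eq_bigr => -[s a] _; rewrite mxE.
have [||v [Hv vmin]] :=
  compact_lipschitz_argmin _ compact_policies_rows (g := f \o vec_mx) G0.
- by exists (mxvec x0); rewrite /= mxvecK.
- by move=> v w Hv Hw /=; rewrite (le_trans (Hf _ _ Hv Hw)) // -linearB /= frob_vec.
exists (vec_mx v); split => // y Hy; rewrite -[y]mxvecK; apply: vmin.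
by rewrite /= mxvecK.
Qed.

End Policies.

Lemma convex_set_segment (m n : nat) (C : set 'M[R]_(m, n)) :
  convex_set C -> segment_closed C.
Proof.
move=> HC x y t Cx Cy /andP[t0 t1].
have := HC y x (Itv01 t0 t1) (mem_set Cy) (mem_set Cx) => /set_mem.
suff -> : x + t *: (y - x) = t *: y + (1 - t) *: x by [].
by rewrite scalerBl scale1r scalerBr addrCA.
Qed.

Section Diameter.
Variables (m n : nat) (C : set 'M[R]_(m, n)) (B : R).
Hypothesis C_bounded : forall x y, C x -> C y -> frob (x - y) <= B.

Lemma le_diameter x y : C x -> C y -> frob (x - y) <= diameter C.
Proof.
move=> Cx Cy; apply: ub_le_sup; last by exists x, y.
by exists B => _ [x' [y' [Cx' Cy' ->]]]; exact: C_bounded.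
Qed.

Lemma diameter_le : C !=set0 -> 0 <= diameter C <= B.
Proof.
move=> [x Cx]; rewrite (le_trans _ (le_diameter Cx Cx)) ?frob_ge0 //=.
apply: ge_sup; first by exists (frob (x - x)), x, x.
by move=> _ [x' [y' [Cx' Cy' ->]]]; exact: C_bounded.
Qed.

End Diameter.

Lemma dist0_le (m n : nat) (C : set 'M[R]_(m, n)) y e :
  C y -> frob y <= e -> dist 0 C <= e.
Proof.
move=> Cy; apply: le_trans; rewrite -frobN -sub0r; apply: ge_inf; last by exists y.
by exists 0 => _ [z _ <-]; exact: frob_ge0.
Qed.

End Compactness.

(** * The regularized game *)

Section Game.
Variables (R : realType) (nS nA : nat) (gamma : R) (rho : 'rV[R]_nS).
Variables (c : 'I_nS -> 'I_nA -> 'I_nS -> R) (P : set 'M[R]_(nS, nA * nS)).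
Variables (D L l r1 r2 : R).
Hypotheses (gamma01 : 0 < gamma < 1) (rho_simplex : simplex rho).
Hypothesis c01 : forall s a s', 0 <= c s a s' <= 1.
Hypotheses (P_ker : P `<=` kernels R nS nA) (P_neq0 : P !=set0).
Hypotheses (P_compact : compact P) (P_convex : convex_set P).
Hypotheses (P_rect : s_rectangular P) (P_mismatch : bounded_mismatch gamma rho c P D).
Hypotheses (pi_lip : grad_pi_lipschitz gamma rho c P L).
Hypotheses (p_lip : grad_p_lipschitz gamma rho c P l).
Hypotheses (L_gt0 : 0 < L) (l_gt0 : 0 < l) (r1_gt0 : 0 < r1).

Local Notation J := (J gamma rho c).
Local Notation Pi := (policies R nS nA).
Local Notation gpi := (grad_pi_J gamma rho c).
Local Notation gp := (grad_p_J gamma rho c).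
Local Notation Pi_bound := (1 + (nS * nA)%:R : R).
Let G : R := J_lipschitz_const nS nA gamma.

Hypothesis Pi_neq0 : Pi !=set0.

Let G_ge0 : 0 <= G. Proof. exact: J_lipschitz_const_ge0. Qed.

Lemma P_segment : segment_closed P. Proof. exact: convex_set_segment. Qed.

Lemma gpi_lip x x' y y' : Pi x -> Pi x' -> P y -> P y' ->
  frob (gpi x y - gpi x' y') <= L * (frob (x - x') + frob (y - y')).
Proof.
move=> Hx Hx' Hy Hy'; have := pi_lip Hx Hx' Hy Hy'.
by rewrite !(has_grad_grad (has_grad_J_pi c gamma01 rho_simplex _ _)) //; apply: P_ker.
Qed.

Lemma gp_lip x x' y y' : Pi x -> Pi x' -> P y -> P y' ->
  frob (gp x y - gp x' y') <= l * (frob (x - x') + frob (y - y')).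
Proof.
move=> Hx Hx' Hy Hy'; have := p_lip Hx Hx' Hy Hy'.
by rewrite !(has_grad_grad (has_grad_J_p c gamma01 rho_simplex _ _)) //; apply: P_ker.
Qed.

Lemma J_quad_pi x x' y : Pi x -> Pi x' -> P y ->
  `|J x' y - J x y - inner (gpi x y) (x' - x)| <= L / 2 * frob (x' - x) ^+ 2.
Proof.
move=> Hx Hx' Hy.
apply: (has_grad_quad (f := fun q => J q y) (gr := fun q => gpi q y)
  (@policies_segment R nS nA) (ltW L_gt0)) => // [q Hq|q q' Hq Hq'].
  by apply: has_grad_J_pi => //; exact: P_ker.
by have := gpi_lip Hq Hq' Hy Hy; rewrite subrr frob0 addr0.
Qed.

Lemma J_quad_p x y y' : Pi x -> P y -> P y' ->
  `|J x y' - J x y - inner (gp x y) (y' - y)| <= l / 2 * frob (y' - y) ^+ 2.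
Proof.
move=> Hx Hy Hy'.
apply: (has_grad_quad (f := J x) (gr := gp x) P_segment (ltW l_gt0)) => // [q Hq|q q' Hq Hq'].
  by apply: has_grad_J_p => //; exact: P_ker.
by have := gp_lip Hx Hx Hq Hq'; rewrite subrr frob0 add0r.
Qed.

Lemma J_le_pi x1 x2 y : Pi x1 -> Pi x2 -> P y ->
  J x2 y - J x1 y <= G * frob (x2 - x1).
Proof.
move=> H1 H2 Hy; apply: le_trans (ler_norm _) _.
by apply: J_lipschitz_pi => //; exact: P_ker.
Qed.

Lemma J_le_p x y1 y2 : Pi x -> P y1 -> P y2 ->
  J x y2 - J x y1 <= G * frob (y2 - y1).
Proof.
move=> Hx H1 H2; apply: le_trans (ler_norm _) _.
by apply: J_lipschitz_p => //; exact: P_ker.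
Qed.

Definition best_pi := best_response J Pi r1.
Definition worst_p := dual_maximizer J Pi P r1.

Lemma best_piP y z : P y -> argmin Pi (fun x => reg J r1 x y z) (best_pi y z).
Proof.
exact: (best_responseP (policies_lipschitz_argmin Pi_neq0) Pi_neq0 G_ge0 (ltW r1_gt0)
  (@policies_bounded R nS nA) J_le_pi).
Qed.

Lemma worst_pP z : argmax P ((dual J r1 best_pi)^~ z) (worst_p z).
Proof.
exact: (dual_maximizerP (policies_lipschitz_argmin Pi_neq0)
  (compact_lipschitz_argmin P_neq0 P_compact) Pi_neq0 G_ge0 (ltW r1_gt0)
  (@policies_bounded R nS nA) J_le_pi J_le_p).
Qed.

Lemma J_dominated_P x y B : Pi x -> P y ->
  (forall y', P y' -> inner (gp x y) (y' - y) <= B) ->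
  forall y', P y' -> J x y' - J x y <= `|D| / (1 - gamma) * B.
Proof. by move=> Hx Py HB; exact: (J_dominated _ _ P_ker P_rect P_mismatch Hx Py HB). Qed.

Lemma phi_argmax x y : Pi x -> P y -> (forall y', P y' -> J x y' <= J x y) ->
  phi gamma rho c P x = J x y.
Proof.
move=> Hx Py ymax; apply/eqP; rewrite eq_le; apply/andP; split.
  by apply: ge_sup => [|_ [y' Py' <-]]; [exists (J x y), y|exact: ymax].
by apply: ub_le_sup; [exists (J x y) => _ [y' Py' <-]; exact: ymax|exists y].
Qed.

Hypothesis r1_ge : 2 * L <= r1.

(* The saddle point of the regularized game identifies the proximal point. *)
Lemma prox_phi_best_pi z : prox_phi gamma rho c P r1 z (best_pi (worst_p z) z).
Proof.
have [Pw wmax] := worst_pP z; have [Hb bmin] := best_piP z Pw.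
have sad y : P y -> J (best_pi (worst_p z) z) y <= J (best_pi (worst_p z) z) (worst_p z).
  exact: (saddle (@policies_segment R nS nA) P_segment L_gt0 l_gt0 r1_ge (lexx (2 * l))
    gpi_lip gp_lip J_quad_pi J_quad_p J_dominated_P best_piP worst_pP).
split=> // q Hq; rewrite (phi_argmax Hb Pw sad).
have [y Py ymax] : exists2 y, P y & forall y', P y' -> J q y' <= J q y.
  by have [y [Py ymax] _] := P_mismatch.1 _ Hq; exists y.
rewrite (phi_argmax Hq Py ymax); apply: le_trans (bmin _ Hq) _.
by rewrite /reg lerD2r ymax.
Qed.

Lemma grad_chi_pi x y z v : Pi x -> P y ->
  grad (fun q => chi gamma rho c r1 r2 q y z v) x = gpi x y + r1 *: (x - z).
Proof.
move=> Hx Py; apply: has_grad_grad; rewrite -[_ + _ in X in has_grad _ _ X]addr0.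
apply: (has_gradD (f := fun q => J q y + r1 / 2 * frob (q - z) ^+ 2)).
  apply: has_gradD; [|exact: has_grad_sqr_dist].
  by apply: has_grad_J_pi => //; exact: P_ker.
exact: has_grad_cst.
Qed.

Lemma grad_chi_p x y z v : Pi x -> P y ->
  grad (fun q => chi gamma rho c r1 r2 x q z v) y = gp x y - r2 *: (y - v).
Proof.
move=> Hx Py; apply: has_grad_grad; rewrite -[gp x y]addr0.
apply: (has_gradD (f := fun q => J x q + r1 / 2 * frob (x - z) ^+ 2)).
  apply: has_gradD; [|exact: has_grad_cst].
  by apply: has_grad_J_p => //; exact: P_ker.
by apply: has_gradN; exact: has_grad_sqr_dist.
Qed.

(** The closed forms of the gradients hold at feasible points; [Proj] makes every iterate
    feasible. *)
Lemma srpg_run_step tau sigma beta mu K pi p bpi bp :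
  srpg_run gamma rho c P r1 r2 tau sigma beta mu K pi p bpi bp ->
  forall k, (k < K)%N ->
  [/\ Proj Pi (pi k - tau *: (gpi (pi k) (p k) + r1 *: (pi k - bpi k))) (pi k.+1),
      Proj P (p k + sigma *: (gp (pi k.+1) (p k) - r2 *: (p k - bp k))) (p k.+1),
      bpi k.+1 = bpi k + beta *: (pi k.+1 - bpi k) &
      bp k.+1 = bp k + mu *: (p k.+1 - bp k)].
Proof.
case=> Hpi0 _ Hp0 _ H k kK.
have Hpi j : (j <= K)%N -> Pi (pi j) /\ P (p j).
  by case: j => [//|j] /H [[? _] [? _] _ _].
have [Hpik Hpk] := Hpi k (ltnW kK); have [Hpik1 _] := Hpi _ kK.
by have := H k kK; rewrite grad_chi_pi // grad_chi_p.
Qed.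

End Game.

Lemma le_div (R : realType) (x y a b : R) : 0 < b -> x <= a / b -> y = x * b -> y <= a.
Proof. by move=> b0 xab ->; rewrite -ler_pdivlMr. Qed.

(** * Consequences of the parameter conditions *)

Section StepSizes.
Variables (R : realType) (L lambda r1 r2 tau sigma : R).
Hypotheses (L_gt0 : 0 < L) (lambda_gt0 : 0 < lambda).
Hypotheses (r1_ge : 2 * L <= r1) (r2_ge : 2 * lambda * L <= r2).

Lemma tau_max_bounds : 0 < tau <= tau_max L lambda r1 ->
  tau * (L + r1) <= 4 / 3 /\ 6 * tau * (lambda * L) <= 1.
Proof.
move: (L_gt0) (lambda_gt0) (r1_ge) => L0 la0 r1p /andP[t0].
rewrite /tau_max le_min => /andP[H1 H2]; split.
  have := le_div (b := 3 * (L + r1)) _ H1 erefl.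
  by move=> /(_ ltac:(rewrite mulr_gt0 //; lra)); lra.
by apply: (le_div _ H2); [rewrite !mulr_gt0|ring].
Qed.

Lemma kappa6E : 0 < tau ->
  tau * (r1 - L) * kappa6 L r1 tau = 2 * tau * r1 + 1.
Proof.
move: (L_gt0) (r1_ge) => L0 r1p t0.
by rewrite /kappa6 mulrC divfK // mulf_neq0 // gt_eqF //; lra.
Qed.

(** The second bound follows from [1 <= kappa1], which gives [2 * (lambda * L) + r2 <= L_phi_pi]. *)
Lemma sigma_max_bounds : 0 < tau -> 0 < sigma <= sigma_max L lambda r1 r2 tau ->
  3 * (lambda * L) * sigma * kappa6 L r1 tau ^+ 2 <= 2 /\
  6 * sigma * (2 * (lambda * L) + r2) <= 1.
Proof.
move: (L_gt0) (lambda_gt0) (r1_ge) (r2_ge) => L0 la0 r1p r2p t0 /andP[s0].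
have l0 : 0 < lambda * L by rewrite mulr_gt0.
rewrite /sigma_max !le_min => /and3P[H1 H2 _].
have k0 : 0 < kappa6 L r1 tau.
  have rL : 0 < r1 - L by lra.
  have r10 : 0 < r1 by lra.
  rewrite /kappa6 divr_gt0 ?mulr_gt0 // addr_gt0 //.
  by rewrite mulr_gt0 // mulr_gt0.
split.
  move: (kappa6 L r1 tau) k0 H1 => k k0 H1.
  have d0 : 0 < 3 * lambda * L * k ^+ 2.
    by rewrite mulr_gt0 ?exprn_gt0 // mulr_gt0 // mulr_gt0.
  by apply: (le_div d0 H1); ring.
have k1 : 1 <= kappa1 L lambda r1.
  by rewrite /kappa1 ler_pdivlMr; lra.
have Lp : 2 * (lambda * L) + r2 <= L_phi_pi L lambda r1 r2.
  rewrite /L_phi_pi; have : lambda * L * 1 <= lambda * L * kappa1 L lambda r1.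
    by rewrite ler_pM2l.
  lra.
have L1 : 0 < 6 * L_phi_pi L lambda r1 r2 by rewrite mulr_gt0 //; lra.
have H3 := le_div L1 H2 erefl.
have : sigma * (2 * (lambda * L) + r2) <= sigma * L_phi_pi L lambda r1 r2.
  by rewrite ler_pM2l.
by move: H3; move: (L_phi_pi _ _ _ _) => ? ? ?; lra.
Qed.

(** The bound 1/15 is 24/360, the other terms of the denominator being nonnegative. *)
Lemma beta_max_le : 0 < sigma -> beta_max L lambda r1 sigma <= 1 / 15.
Proof.
move: (L_gt0) (lambda_gt0) (r1_ge) => L0 la0 r1p s0.
rewrite /beta_max ge_min; apply/orP; left.
have r10 : 0 < r1 by lra.
have h1 : 0 <= 5 * r1 ^+ 2 * lambda by rewrite mulr_ge0 ?mulr_ge0 ?sqr_ge0 // ltW.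
have h2 := sqr_ge0 (2 * lambda * L + 5 * r1).
move: h1 h2; set A := 5 * _ * lambda; set B := (_ + _) ^+ 2 => h1 h2.
by rewrite ler_pdivrMr; lra.
Qed.

End StepSizes.

Lemma root4_facts (R : realType) (K : nat) : (2 <= K)%N ->
  let kap := K%:R `^ (4^-1) : R in
  [/\ 1 <= kap, kap ^+ 4 = K%:R & K%:R `^ (- 2^-1) = (kap ^+ 2)^-1].
Proof.
move=> K2 /=.
have K0 : 0 <= K%:R :> R by rewrite ler0n.
set kap := _ `^ _; have k0 : 0 <= kap := powR_ge0 _ _.
have k4 : kap ^+ 4 = K%:R.
  by rewrite -powR_mulrn // -powRrM mulVf ?powRr1 // gt_eqF.
split=> //.
  rewrite leNgt; apply/negP => k1.
  have : kap ^+ 4 <= 1 by rewrite exprn_ile1 // ltW.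
  by rewrite k4 lern1 leqNgt K2.
rewrite powRN; congr (_^-1); rewrite -powR_mulrn // -powRrM; congr (_ `^ _).
by field.
Qed.

Theorem theorem4p1 (R : realType) (nS nA : nat) (gamma : R) (rho : 'rV[R]_nS)
    (D L lambda r1 r2 tau sigma mu c1 c2 : R)
    (gamma01 : 0 < gamma < 1) (rho_simplex : simplex rho)
    (L_gt0 : 0 < L) (lambda_gt0 : 0 < lambda)
    (r1_ge : 2 * L <= r1) (r1_gt : ell_pi nA gamma < r1)
    (r2_ge : 2 * lambda * L <= r2)
    (tauP : 0 < tau <= tau_max L lambda r1)
    (sigmaP : 0 < sigma <= sigma_max L lambda r1 r2 tau)
    (mu01 : 0 < mu < 1) (mu_le : mu <= mu_max L lambda r2 sigma)
    (c1_gt0 : 0 < c1) (c1_le_c2 : c1 <= c2) :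
  exists2 C : R, 0 < C &
  forall (c : 'I_nS -> 'I_nA -> 'I_nS -> R) (P : set 'M[R]_(nS, nA * nS)),
    (forall s a s', 0 <= c s a s' <= 1) ->
    P `<=` kernels R nS nA -> P !=set0 -> compact P -> convex_set P ->
    s_rectangular P ->
    bounded_mismatch gamma rho c P D ->
    grad_pi_lipschitz gamma rho c P L ->
    grad_p_lipschitz gamma rho c P (lambda * L) ->
  forall beta : nat -> R,
    (forall K : nat, (2 <= K)%N ->
       [/\ 0 < beta K < 1, beta K <= beta_max L lambda r1 sigma &
           c1 * K%:R `^ (- 2^-1) <= beta K <= c2 * K%:R `^ (- 2^-1)]) ->
  forall K : nat, (2 <= K)%N ->
  forall (pi bpi : nat -> 'M[R]_(nS, nA)) (p bp : nat -> 'M[R]_(nS, nA * nS)),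
    srpg_run gamma rho c P r1 r2 tau sigma (beta K) mu K pi p bpi bp ->
  let eps := C * (Num.sqrt (diameter (policies R nS nA))
                  + Num.sqrt (diameter P)) / K%:R `^ (4^-1) in
  (exists k1 : nat, (0 < k1 < K)%N /\
     game_stationary gamma rho c P eps (pi k1.+1) (p k1.+1)) /\
  (exists k2 : nat, (0 < k2 < K)%N /\
     opt_stationary gamma rho c P r1 eps (bpi k2.+1)).
Proof.
have [tau0 _] := andP tauP; have [sigma0 _] := andP sigmaP; have [mu0 _] := andP mu01.
have [tau1 tau2] := tau_max_bounds L_gt0 lambda_gt0 r1_ge tauP.
have kapE := kappa6E L_gt0 r1_ge tau0.
have [sigma1 sigma2] := sigma_max_bounds L_gt0 lambda_gt0 r1_ge r2_ge tau0 sigmaP.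
have l_gt0 : 0 < lambda * L by rewrite mulr_gt0.
have beta_le := beta_max_le L_gt0 lambda_gt0 r1_ge sigma0.
rewrite -mulrA in r2_ge.
move: (lambda * L) l_gt0 r2_ge tau2 sigma2 (kappa6 L r1 tau) kapE sigma1 =>
  l l_gt0 r2_ge tau2 sigma2 kappa kapE sigma1.
have r10 : 0 < r1 by lra.
have r20 : 0 < r2 by lra.
have rL : 0 < r1 - L by lra.
have taui : 0 < tau^-1 by rewrite invr_gt0.
have sigmai : 0 < sigma^-1 by rewrite invr_gt0.
have kap0 : 0 < kappa.
  have h : 0 < tau * (r1 - L) by rewrite mulr_gt0.
  rewrite -(pmulr_rgt0 _ h) kapE addr_gt0 // mulr_gt0 // mulr_gt0 //.
(* The absolute value, because the constant is chosen before [bounded_mismatch] is available to give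
   [0 <= D]. *)
pose M := `|D| / (1 - gamma).
have M0 : 0 <= M by rewrite divr_ge0 // subr_ge0 ltW //; case/andP: gamma01.
(* Diameter bounds that hold for all policies and all kernels, hence are chosen before [P]. *)
pose BX : R := 1 + (nS * nA)%:R.
pose BY : R := 1 + (nS * (nA * nS))%:R.
have BX0 : 0 <= BX by rewrite addr_ge0.
have BY0 : 0 <= BY by rewrite addr_ge0.
pose G := J_lipschitz_const nS nA gamma.
have G0 : 0 <= G by exact: J_lipschitz_const_ge0.
(* A common lower bound of the descent coefficients; the entry [r1 / 8] is what [weighted_step] asks
   for. *)
pose m0 := Num.min (Num.min (6 * tau)^-1 (8 * sigma)^-1) (Num.min (r2 * mu / 2) (r1 / 8)).
have m00 : 0 < m0.
  rewrite !lt_min !invr_gt0 !divr_gt0 ?mulr_gt0 //.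
have [mx my mv mr] : [/\ m0 <= (6 * tau)^-1, m0 <= (8 * sigma)^-1,
    m0 <= r2 * mu / 2 & m0 <= r1 / 8].
  by rewrite /m0; split; rewrite !ge_min lexx ?orbT.
have mr8 : 8 * m0 <= r1 by lra.
have gap0 : 0 <= gap_const L l r1 r2 M sigma kappa.
  have lk : 0 < l * kappa by rewrite mulr_gt0.
  rewrite /gap_const divr_ge0 ?(ltW rL) //.
  by apply: mulr_ge0; [rewrite (mulr_ge0 _ M0)|lra].
have range0 : 0 <= range_const r1 r2 G BX BY.
  by rewrite /range_const !addr_ge0 // mulr_ge0 // ltW.
have [C0 C00 HC0] := rate_of_weighted_sum c2 m00 r10 mr8 gap0 range0 BY0 c1_gt0.
have res0 : 0 < residual_const L l r1 r2 tau sigma kappa by rewrite /residual_const; lra.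
exists (residual_const L l r1 r2 tau sigma kappa * C0); first by rewrite mulr_gt0.
move=> c P c01 P_ker P_neq0 P_compact P_convex P_rect P_mis pi_lip p_lip beta betaP
  K K2 pi bpi p bp run.
have [/andP[b0 b1] bmax] := betaP K K2.
have [kap1 kap4 kapm] := root4_facts R K2; rewrite kapm.
move: (K%:R `^ _) kap1 kap4 {kapm} => kap kap1 kap4 brate /=.
have bl : beta K <= 1 / 15 := le_trans bmax beta_le.
have [pi0 bpi0 p0 bp0 _] := run.
(* For [nA = 0] there is no policy; the start of the run provides one. *)
have Pi_neq0 : policies R nS nA !=set0 by exists (pi 0%N).
have XB := @policies_bounded R nS nA.
have YB x y : P x -> P y -> frob (x - y) <= BY.
  by move=> /P_ker Kx /P_ker Ky; exact: kernels_bounded.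
have bestP := best_piP gamma01 rho_simplex c01 P_ker r10 Pi_neq0.
have worstP := worst_pP gamma01 rho_simplex c01 P_ker P_neq0 P_compact r10 Pi_neq0.
have steps := srpg_run_step gamma01 rho_simplex P_ker run.
have [k k1 [[g1 N1 H1] [g2 N2 H2] H3]] := run_stationary
  (@policies_segment R nS nA) (P_segment P_convex) L_gt0 l_gt0 r1_ge r2_ge
  (gpi_lip gamma01 rho_simplex P_ker pi_lip) (gp_lip gamma01 rho_simplex P_ker p_lip)
  (J_quad_pi gamma01 rho_simplex P_ker pi_lip L_gt0)
  (J_quad_p gamma01 rho_simplex P_ker P_convex p_lip l_gt0)
  (J_dominated_P gamma01 rho_simplex P_ker P_rect P_mis) bestP worstP
  tau0 sigma0 b0 bl mu01 tau1 tau2 kapE sigma1 sigma2 pi0 p0 bpi0 bp0 steps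
  (J_le_pi gamma01 rho_simplex c01 P_ker) (J_le_p gamma01 rho_simplex c01 P_ker) G0
  (le_diameter XB) (le_diameter YB) (diameter_le XB Pi_neq0) (diameter_le YB P_neq0) M0
  mx my mv K2 kap1 kap4 brate HC0.
move: H1 H2 H3; rewrite !mulrA; set eps := _ / kap => H1 H2 H3.
have [_ kK] := andP k1.
have [Xx Px Xz _] := run_feasible (@policies_segment R nS nA) (P_segment P_convex)
  b0 bl mu01 pi0 p0 bpi0 bp0 steps kK.
split; exists k; split=> //; last first.
  split=> //.
  exists (best_pi gamma rho c r1 (worst_p gamma rho c P r1 (bpi k.+1)) (bpi k.+1)) => //.
  exact: (prox_phi_best_pi gamma01 rho_simplex c01 P_ker P_neq0 P_compact P_convex
    P_rect P_mis pi_lip p_lip L_gt0 l_gt0 r10 Pi_neq0 r1_ge).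
split=> //.
  rewrite (has_grad_grad (has_grad_J_pi c gamma01 rho_simplex Xx (P_ker _ Px))).
  by apply: dist0_le H1; exists g1.
rewrite (has_grad_grad (has_grad_J_p c gamma01 rho_simplex Xx (P_ker _ Px))).
by apply: dist0_le H2; exists g2.
Qed.
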